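(* Both $\mathrm{Horiz}(\mathcal{D}_h)(L)$ and $\mathrm{Horiz}(\mathcal{PD}_h)(L)$ are symplectic manifolds relative to the form $\omega$ defined by $$\omega_{\Lambda}(V_1,V_2)=\frac1i\int_0^L\Big\langle \Lambda(s),\Big[\frac{dV_1}{ds}(s),\frac{dV_2}{ds}(s)\Big]\Big\rangle\,ds$$ for any tangent vectors $g(s)V_1(s),\,g(s)V_2(s)$ at a horizontal Darboux curve $g(s)$ with $\Lambda(s)=g(s)^{-1}\frac{dg}{ds}(s)$.
   Context: Notation. $G=SL_2(\mathbb C)$, $K=SU_2$; $\mathfrak g=\mathfrak{sl}_2(\mathbb C)=\mathfrak h+\mathfrak k$, where $\mathfrak h$ and $\mathfrak k$ are the spaces of trace-zero Hermitian and trace-zero skew-Hermitian matrices. The bracket convention is $[A,B]=BA-AB$, and $\langle A,B\rangle=2\,\mathrm{Tr}(AB)$ on $\mathfrak g$, which is positive definite on $\mathfrak h$. $B_1=\frac12\,\mathrm{diag}(1,-1)$. All curves are smooth. Spaces of curves. $\mathrm{Horiz}(\mathcal{D}_h)(L)$ is the set of anchored hyperbolic horizontal Darboux curves: curves $g:[0,L]\to G$ with $g(0)=I$ and $g^{-1}(s)\frac{dg}{ds}(s)=\Lambda(s)=R(s)B_1R^*(s)$ for some curve $R(s)$ in $K$ with $R(0)=I$. Such a curve is frame-periodic if its tangent vector $\Lambda(s)$ is periodic with period $L$; $\mathrm{Horiz}(\mathcal{PD}_h)(L)$ is the set of frame-periodic ones. Both are considered as infinite-dimensional Fréchet manifolds.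 Tangent vectors. A tangent vector at $g$ is $v(s)=\frac{\partial h}{\partial t}(s,t)\big|_{t=0}$ for a family $h(s,t)$ of curves in the space with $h(s,0)=g(s)$; it is written $v(s)=g(s)V(s)$, i.e. $V=g^{-1}v$. The tangent space of $\mathrm{Horiz}(\mathcal{D}_h)(L)$ at $g$ is described as consisting of the curves $v(s)=g(s)V(s)$ with $V(s)$ a Hermitian curve satisfying $V(0)=0$, $\frac{dV}{ds}(0)=0$ and $\langle\Lambda(s),\frac{dV}{ds}(s)\rangle=0$. For $\mathrm{Horiz}(\mathcal{PD}_h)(L)$ one requires in addition that $\frac{dV}{ds}(s)$ be smoothly periodic with period $L$. Symplectic. A differential form $\omega$ of degree 2 on a Fréchet manifold is symplectic if it is closed ($d\omega=0$) and non-degenerate, in the sense that the induced form $(i_X\omega)(Y)=\omega(X,Y)$ is non-zero for each non-zero vector field $X$.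
   Formalization: The relation V = g⁻¹v, impossible for nonzero Hermitian V, is replaced: dV/ds = dW/ds + [W,Λ] with W = g⁻¹v (the variation of Λ), V(0) = 0; ω closed is read as closed pull-backs to all smooth finite-parameter families in the space. *)

(* Defs.v *)
From mathcomp Require Import all_boot all_order all_algebra.
From mathcomp Require Import complex.
From mathcomp Require Import all_classical all_reals all_analysis.

Set Implicit Arguments.
Unset Strict Implicit.
Unset Printing Implicit Defensive.

Import Order.TTheory GRing.Theory Num.Theory.
Import numFieldNormedType.Exports.

Local Open Scope classical_set_scope.
Local Open Scope ring_scope.
Local Open Scope complex_scope.
Local Open Scope sesquilinear_scope.

Section MatrixCalculus.
Variable R : realType.

(* R[i] carries no normed structure over R in the library, so calculus with
   complex matrices is done on the real and imaginary parts of the entries. *)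

Fixpoint class_C (k : nat) (V : normedModType R) (f : V -> R) : Prop :=
  if k is k'.+1 then
    [/\ continuous f, forall x v, derivable f x v
      & forall v, class_C k' (fun x => 'D_v f x)]
  else continuous f.

Definition smooth (V : normedModType R) (f : V -> R) : Prop :=
  forall k, class_C k f.

Definition smooth_mx (V : normedModType R) (F : V -> 'M[R[i]]_2) : Prop :=
  forall i j, smooth (fun x => complex.Re (F x i j))
           /\ smooth (fun x => complex.Im (F x i j)).

Definition D_mx (V : normedModType R) (v : V) (F : V -> 'M[R[i]]_2) (x : V) :
    'M[R[i]]_2 :=
  \matrix_(i, j) ('D_v (fun y => complex.Re (F y i j)) x
               +i* 'D_v (fun y => complex.Im (F y i j)) x).

Definition ddt (F : R -> 'M[R[i]]_2) (s : R) : 'M[R[i]]_2 :=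
  D_mx (V := R) 1 F s.

Definition integral_C (a b : R) (f : R -> R[i]) : R[i] :=
  (\int[lebesgue_measure]_(s in `[a, b]) complex.Re (f s))
  +i* (\int[lebesgue_measure]_(s in `[a, b]) complex.Im (f s)).

End MatrixCalculus.

(* A curve [0, L] -> 'M_2 is represented by a smooth function on the whole
   real line extending it; every condition, derivative and integral below only
   concerns parameters s in [0, L]. *)
Definition curve (R : realType) : Type := R -> 'M[R[i]]_2.

Section HyperbolicDarboux.
Variables (R : realType) (L : R).
Local Notation M2 := 'M[R[i]]_2.
Local Notation curve := (curve R).

Definition G (A : M2) : Prop := \det A = 1.

Definition K (A : M2) : Prop := A \is unitarymx /\ \det A = 1.

Definition herm0 (A : M2) : Prop := A ^t* = A /\ \tr A = 0.

(* The sign convention is opposite to the usual commutator. *)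
Definition bracket (A B : M2) : M2 := B *m A - A *m B.

Definition pairing (A B : M2) : R[i] := 2 * \tr (A *m B).

Definition B1 : M2 := 2^-1 *: diag_mx (\row_(j < 2) (-1) ^+ j).

Definition Lam (g : curve) : curve := fun s => invmx (g s) *m ddt g s.

Definition smoothly_periodic (c : curve) : Prop :=
  exists P : curve, [/\ smooth_mx (V := R) P,
    forall s, P (s + L) = P s
    & forall s, s \in `[0, L] -> P s = c s].

Definition HorizD : set curve := [set g |
  [/\ smooth_mx (V := R) g,
      forall s, s \in `[0, L] -> G (g s),
      g 0 = 1%:M
    & exists r : curve,
      [/\ smooth_mx (V := R) r,
          forall s, s \in `[0, L] -> K (r s),
          r 0 = 1%:M
        & forall s, s \in `[0, L] -> Lam g s = r s *m B1 *m (r s) ^t*]]].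

Definition HorizPD : set curve :=
  [set g | HorizD g /\ smoothly_periodic (Lam g)].

Definition TD (g : curve) : set curve := [set V |
  [/\ smooth_mx (V := R) V,
      forall s, s \in `[0, L] -> herm0 (V s),
      V 0 = 0,
      ddt V 0 = 0
    & forall s, s \in `[0, L] -> pairing (Lam g s) (ddt V s) = 0]].

Definition TPD (g : curve) : set curve :=
  [set V | TD g V /\ smoothly_periodic (ddt V)].

(* Depends on g through Lam g only. *)
Definition omega (g V1 V2 : curve) : R[i] :=
  'i^-1 * integral_C 0 L (fun s =>
    pairing (Lam g s) (bracket (ddt V1 s) (ddt V2 s))).

(* V is the Hermitian curve attached to a velocity v of a family of horizontal
   curves through g.  Put W = g^-1 v.  The derivative dV/ds is the covariant
   derivative of v along g, pulled back to the identity by g, that is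
   dW/ds + [W, Lam] in the present bracket convention; by equality of mixed
   partial derivatives this is the variation of Lam along the family.
   Consequently dV/ds is Hermitian and orthogonal to Lam (whose length is
   constant), vanishes at 0 (where Lam = B1), and is smoothly periodic if Lam
   stays so along the family: V satisfies the conditions of TD, resp. TPD.
   The curve W itself is not Hermitian in general. *)
Definition represents (g v V : curve) : Prop :=
  let W := fun s => invmx (g s) *m v s in
  [/\ smooth_mx (V := R) V, V 0 = 0
    & forall s, s \in `[0, L] -> ddt V s = ddt W s + bracket (W s) (Lam g s)].

Definition jointly_smooth (n : nat) (h : 'rV[R]_n -> curve) : Prop :=
  smooth_mx (V := (R * 'rV[R]_n)%type) (fun p => h p.2 p.1).

Definition smooth_family (M : set curve) (n : nat) (h : 'rV[R]_n -> curve) :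
    Prop :=
  jointly_smooth h /\ forall t, M (h t).

Definition velocity (n : nat) (h : 'rV[R]_n -> curve) (j : 'I_n)
    (t : 'rV[R]_n) : curve :=
  fun s => D_mx (delta_mx 0 j) (fun t' => h t' s) t.

(* In the following, M is a space of curves and T its tangent spaces.  The
   smooth structure of M is given by the smooth finite-dimensional families in
   M: a form is smooth, resp. closed, when its pull-backs to the parameter
   spaces of all such families are. *)
Definition two_form (M : set curve) (T : curve -> set curve)
    (om : curve -> curve -> curve -> R[i]) : Prop :=
  [/\ forall g V1 V2, M g -> T g V1 -> T g V2 -> om g V1 V2 \is Num.real,
      forall g (a : R) V1 V2 V3, M g -> T g V1 -> T g V2 -> T g V3 ->
        om g (fun s => a%:C *: V1 s + V2 s) V3
          = a%:C * om g V1 V3 + om g V2 V3,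
      forall g V1 V2, M g -> T g V1 -> T g V2 -> om g V2 V1 = - om g V1 V2
    & forall n (h V1 V2 : 'rV[R]_n -> curve), smooth_family M h ->
        jointly_smooth V1 -> jointly_smooth V2 ->
        (forall t, T (h t) (V1 t)) -> (forall t, T (h t) (V2 t)) ->
        smooth (fun t => complex.Re (om (h t) (V1 t) (V2 t)))].

(* The exterior derivative evaluated on the coordinate fields d/dt_i, d/dt_j, d/dt_k, which commute. *)
Definition closed_form (M : set curve)
    (om : curve -> curve -> curve -> R[i]) : Prop :=
  forall n (h : 'rV[R]_n -> curve) (V : 'I_n -> 'rV[R]_n -> curve),
    smooth_family M h ->
    (forall j t, represents (h t) (velocity h j t) (V j t)) ->
    let om_h j k := fun t => complex.Re (om (h t) (V j t) (V k t)) in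
    let partial i (f : 'rV[R]_n -> R) := fun t => 'D_(delta_mx 0 i) f t in
    forall i j k t,
      partial i (om_h j k) t + partial j (om_h k i) t
        + partial k (om_h i j) t = 0.

(* Vector fields are arbitrary sections here, so that non-degeneracy, required
   at each point where the field is non-zero, is the pointwise one. *)
Definition vector_field (M : set curve) (T : curve -> set curve)
    (X : curve -> curve) : Prop :=
  forall g, M g -> T g (X g).

Definition non_degenerate (M : set curve) (T : curve -> set curve)
    (om : curve -> curve -> curve -> R[i]) : Prop :=
  forall X, vector_field M T X ->
  forall g, M g -> (exists2 s, s \in `[0, L] & X g s != 0) ->
  exists2 Y, T g Y & om g (X g) Y != 0.

Definition symplectic (M : set curve) (T : curve -> set curve)
    (om : curve -> curve -> curve -> R[i]) : Prop :=
  [/\ two_form M T om, closed_form M om & non_degenerate M T om].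

End HyperbolicDarboux.

(* Main.v *)
Require Import Defs.
From mathcomp Require Import all_boot all_order all_algebra.
From mathcomp Require Import ring lra.
From mathcomp Require Import complex.
From mathcomp Require Import all_classical all_reals all_analysis.

Set Implicit Arguments.
Unset Strict Implicit.
Unset Printing Implicit Defensive.

Import Order.TTheory GRing.Theory Num.Theory.
Import numFieldNormedType.Exports.

Local Open Scope classical_set_scope.
Local Open Scope ring_scope.
Local Open Scope complex_scope.
Local Open Scope sesquilinear_scope.

(** Traceless Hermitian matrices form a three-dimensional Euclidean space with
    coordinates [x1], [x2], [x3].  There [pairing] is four times the dot
    product and [bracket] is, up to the factor 2i, the vector product, so that
    for Hermitian velocities
<<
      omega g V1 V2 = 8 * int_0^L vol (lam s) (V1' s) (V2' s) ds
>>
    with [vol] the triple product ([omegaE]).  The logarithmic derivative [lam]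
    of a horizontal curve moves on a sphere of radius 1/2 ([Lam_sphere]), and
    the tangent vectors are the curves V with V' orthogonal to it.  The form is
    therefore an integral over [0, L] of multiples of the area form of this
    sphere, and both properties are inherited from the sphere.

    Closedness.  Along a family h of horizontal curves, the curve V attached to
    the parameter t_j satisfies V' = d lam / d t_j ([ddt_variation]).  Both
    sides are computed from h lam = dh/ds and the equality of mixed partial
    derivatives.  Differentiating under the integral sign, the cyclic sum
    which expresses the exterior derivative has the integrand
    8 (3 vol (lam_i, lam_j, lam_k)) plus second derivatives of lam that cancel
    in pairs.  The remaining triple product vanishes because the three partial
    derivatives of lam are all orthogonal to lam, hence coplanar
    ([cyclic_omega_density]).

    Non-degeneracy.  Given V, let Y' be the vector product of lam and V': up
    to the factor 1/2, a quarter turn in the tangent plane of the sphere, which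
    keeps the conditions on V', periodicity included.  Then vol (lam, V', Y') = |V'|^2 / 4, and if
    omega g V Y were zero then V' would vanish on [0, L], and V with it
    ([TD_partner]).

    Smoothness of the form is the smoothness of integrals depending on a
    parameter ([smooth_integral_over]).  As smoothness is expressed by
    directional derivatives, this and the equality of mixed derivatives
    ([derive_comm]) only need the mean value theorem on lines, together
    with the compactness of [0, L] for the former.  A curve is
    constrained on [0, L] only, and the matrices g s may be singular elsewhere;
    for this reason [lam] is defined with the adjugate, which agrees with the
    inverse where the determinant is 1 and is polynomial in the entries. *)

(** * Smooth functions on a normed space *)

Section SmoothFunctions.
Variables (R : realType) (V : normedModType R).
Implicit Types f g : V -> R.

Lemma class_CW k f : class_C k.+1 f -> class_C k f.
Proof.
elim: k f => [|k IHk] f; first by case.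
by case=> cf df Hf; split=> // v; apply/IHk/Hf.
Qed.

Lemma class_C_cst k (c : R) : class_C k (fun _ : V => c).
Proof.
elim: k c => [|k IHk] c; first exact: cst_continuous.
split=> [|x v|v]; [exact: cst_continuous|exact (derivable_cst c x v)|].
by under eq_fun do rewrite (derive_cst c _ v); exact: IHk.
Qed.

(** Pointwise forms of the rules for the operations of the ring of functions:
    a lambda abstraction does not match a sum of functions syntactically. *)
Lemma deriveDE f g x v : derivable f x v -> derivable g x v ->
  'D_v (fun y => f y + g y) x = 'D_v f x + 'D_v g x.
Proof. exact: deriveD. Qed.

Lemma deriveME f g x v : derivable f x v -> derivable g x v ->
  'D_v (fun y => f y * g y) x = f x * 'D_v g x + g x * 'D_v f x.
Proof. exact: deriveM. Qed.

Lemma deriveBE f g x v : derivable f x v -> derivable g x v ->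
  'D_v (fun y => f y - g y) x = 'D_v f x - 'D_v g x.
Proof. exact: deriveB. Qed.

Lemma class_CD k f g :
  class_C k f -> class_C k g -> class_C k (fun x => f x + g x).
Proof.
elim: k f g => [|k IHk] f g; first by move=> cf cg x; exact: (continuousD (cf x) (cg x)).
move=> [cf df Hf] [cg dg Hg]; split=> [x|x v|v].
- exact: (continuousD (cf x) (cg x)).
- exact (derivableD (df x v) (dg x v)).
- by under eq_fun do rewrite deriveDE//; exact: (IHk _ _ (Hf v) (Hg v)).
Qed.

Lemma class_CM k f g :
  class_C k f -> class_C k g -> class_C k (fun x => f x * g x).
Proof.
elim: k f g => [|k IHk] f g; first by move=> cf cg x; exact: (continuousM (cf x) (cg x)).
move=> Hf Hg; have [cf df Df] := Hf; have [cg dg Dg] := Hg.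
split=> [x|x v|v].
- exact: (continuousM (cf x) (cg x)).
- exact (derivableM (df x v) (dg x v)).
under eq_fun do rewrite deriveME//.
apply: class_CD.
- exact: (IHk _ _ (class_CW Hf) (Dg v)).
- exact: (IHk _ _ (class_CW Hg) (Df v)).
Qed.

Lemma smooth_continuous f : smooth f -> continuous f.
Proof. by move=> /(_ 0). Qed.

Lemma smooth_derivable f x v : smooth f -> derivable f x v.
Proof. by move=> /(_ 1) []. Qed.

Lemma smooth_derive f v : smooth f -> smooth (fun x => 'D_v f x).
Proof. by move=> sf k; have [_ _] := sf k.+1; exact. Qed.

Lemma smooth_cst (c : R) : smooth (fun _ : V => c).
Proof. by move=> k; exact: class_C_cst. Qed.

Lemma smoothD f g : smooth f -> smooth g -> smooth (fun x => f x + g x).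
Proof. by move=> sf sg k; exact: class_CD. Qed.

Lemma smoothM f g : smooth f -> smooth g -> smooth (fun x => f x * g x).
Proof. by move=> sf sg k; exact: class_CM. Qed.

Lemma smoothN f : smooth f -> smooth (fun x => - f x).
Proof.
move=> sf; under eq_fun do rewrite -mulN1r.
by apply: smoothM => //; exact: smooth_cst.
Qed.

Lemma smoothB f g : smooth f -> smooth g -> smooth (fun x => f x - g x).
Proof. by move=> sf sg; apply: smoothD => //; exact: smoothN. Qed.

Lemma is_derive_line f p u (a : R) : derivable f (p + a *: u) u ->
  is_derive a 1 (fun b : R => f (p + b *: u)) ('D_u f (p + a *: u)).
Proof.
have lineE : (fun h : R => h^-1 *:
      (((fun b => f (p + b *: u)) \o shift a) (h *: 1) - f (p + a *: u))) =
    (fun h : R => h^-1 *: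
      ((f \o shift (p + a *: u)) (h *: u) - f (p + a *: u))).
  apply/funext => h /=; congr (_ *: (f _ - _)).
  by rewrite scalerDl [in LHS]/GRing.scale/= mulr1 addrCA.
move=> df; split; first by rewrite /derivable lineE.
by rewrite /derive lineE.
Qed.

(** The increment h may be negative, so that the lemma also bounds two-sided
    difference quotients. *)
Lemma mean_value_line f p u (h : R) : (forall x, derivable f x u) ->
  exists2 c : R, `|c| <= `|h| & f (p + h *: u) - f p = h * 'D_u f (p + c *: u).
Proof.
move=> df; have dl a := is_derive_line (df (p + a *: u)).
have cl : continuous (fun b : R => f (p + b *: u)).
  move=> a; apply: differentiable_continuous.
  by apply/derivable1_diffP; have [] := dl a.
have cw A : {within A, continuous (fun b : R => f (p + b *: u))}.
  exact: continuous_subspaceT.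
have [h0|h0|->] := ltgtP h 0; last first.
- by exists 0; rewrite ?scale0r ?addr0 ?subrr ?mul0r.
- have [c /[!in_itv]/= /andP[c0 ch]] := MVT h0 (fun x _ => dl x) (cw _).
  rewrite scale0r addr0 subr0 mulrC => ->; exists c => //.
  by rewrite !gtr0_norm// ltW.
- have [c /[!in_itv]/= /andP[hc c0]] := MVT h0 (fun x _ => dl x) (cw _).
  rewrite scale0r addr0 sub0r => E; exists c.
  + by rewrite !ltr0_norm// lerN2 ltW.
  + by rewrite -opprB E mulrN opprK mulrC.
Qed.

(** The mean value theorem, first along u for the increment of f in the
    direction v, then along v for the derivative of f in the direction u. *)
Lemma second_difference f x u v (a : R) : class_C 2 f -> 0 < a ->
  exists s t, [/\ `|s| <= a, `|t| <= a & f (x + a *: u + a *: v) - f (x + a *: u)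
     - (f (x + a *: v) - f x) =
     a ^+ 2 * 'D_v (fun y => 'D_u f y) (x + s *: u + t *: v)].
Proof.
move=> [cf df Df] a0.
pose g y := f (y + a *: v) - f y.
have dgE y : is_derive y u g ('D_u f (y + a *: v) - 'D_u f y).
  have dshift : is_derive y u (fun z => f (z + a *: v)) ('D_u f (y + a *: v)).
    have E : (fun h : R => h^-1 *: (((fun z => f (z + a *: v)) \o shift y) (h *: u)
         - f (y + a *: v))) =
      (fun h : R => h^-1 *: ((f \o shift (y + a *: v)) (h *: u) - f (y + a *: v))).
      by apply/funext => h /=; rewrite addrA.
    by split; [rewrite /derivable E; exact: df|rewrite /derive E].
  exact (is_deriveB dshift (derivableP (df y u))).
have [s sa Es] : exists2 c : R, `|c| <= `|a|
    & g (x + a *: u) - g x = a * 'D_u g (x + c *: u).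
  by apply: mean_value_line => y; have [] := dgE y.
have [_ du _] := Df u.
have [t ta Et] := mean_value_line (x + s *: u) a (fun y => du y v).
exists s, t; rewrite -(gtr0_norm a0); split=> //.
rewrite (gtr0_norm a0) expr2 -mulrA -Et; move: Es; rewrite /g => ->.
by congr (_ * _); rewrite (@derive_val _ _ _ _ _ _ _ (dgE _)).
Qed.

Lemma continuous_corner f x u v (e : R) : continuous f -> 0 < e ->
  exists2 a : R, 0 < a & forall b s t, b <= a -> `|s| <= b -> `|t| <= b ->
    `|f x - f (x + s *: u + t *: v)| < e.
Proof.
move=> cf e0.
have /cvgrPdist_lt /(_ _ e0) /nbhs_ballP [d /= d0 dP] := cf x.
have N0 : 0 < `|u| + `|v| + 1 by rewrite ltr_wpDl// addr_ge0.
exists (d / (`|u| + `|v| + 1)); first exact: divr_gt0.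
move=> b s t ba sb tb; apply: dP; rewrite -ball_normE /ball_/=.
rewrite -addrA opprD addrA subrr sub0r normrN.
apply: (le_lt_trans (ler_normD _ _)); rewrite !normrZ.
apply: (@le_lt_trans _ _ (d / (`|u| + `|v| + 1) * (`|u| + `|v|))).
  rewrite mulrDr lerD// ler_wpM2r//; exact: (le_trans _ ba).
rewrite -mulrA -ltr_pdivlMl// mulVf ?gt_eqF//.
by rewrite mulrC ltr_pdivrMr// mul1r ltrDl.
Qed.

(** Both iterated derivatives are limits of the same symmetric second
    difference quotient. *)
Lemma derive_comm f x u v : class_C 2 f ->
  'D_u (fun y => 'D_v f y) x = 'D_v (fun y => 'D_u f y) x.
Proof.
move=> Hf; have [cf df Df] := Hf.
have c2 w w' : continuous (fun y => 'D_w (fun z => 'D_w' f z) y).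
  by have [_ _ /(_ w)] := Df w'.
apply/eqP; rewrite -subr_eq0 -normr_le0 leNgt; apply/negP => e0.
set e := `|_ - _| in e0; have e20 : 0 < e / 2 by rewrite divr_gt0.
have [a a0 Ha] := continuous_corner x u v (c2 v u) e20.
have [b b0 Hb] := continuous_corner x v u (c2 u v) e20.
pose m := Num.min a b; have m0 : 0 < m by rewrite lt_min a0.
have [s [t [sm tm E]]] := second_difference x u v Hf m0.
have [s' [t' [sm' tm' E']]] := second_difference x v u Hf m0.
have := ltrD (Ha m s t _ sm tm) (Hb m s' t' _ sm' tm').
rewrite !ge_min !lexx orbT -splitr => /(_ isT isT).
have -> : 'D_v (fun y => 'D_u f y) (x + s *: u + t *: v) =
          'D_u (fun y => 'D_v f y) (x + s' *: v + t' *: u).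
  have swap (p q r w : R) : p - q - (r - w) = p - r - (q - w) by ring.
  apply: (@mulfI _ (m ^+ 2)); first by rewrite expf_neq0// gt_eqF.
  by rewrite -E -E' [x + m *: v + _]addrAC; exact: swap.
set A := 'D_u _ _; rewrite ltNge => /negP; apply.
by rewrite addrC [X in _ + X]distrC; exact: ler_distD.
Qed.

End SmoothFunctions.

(** * Calculus on a segment *)

Section SegmentCalculus.
Variable R : realType.
Implicit Types (a b s : R) (f F : R -> R).
Local Notation mu := (@lebesgue_measure R).

(** At an endpoint the derivative is already determined by the difference
    quotients that stay in the segment. *)
Lemma derive_vanishing a b f s : a < b -> s \in `[a, b] ->
  (forall x, x \in `[a, b] -> f x = 0) -> derivable f s 1 -> 'D_1 f s = 0.
Proof.
move=> ab sab f0 df; apply/eqP; rewrite -normr_le0 leNgt; apply/negP => e0.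
have /cvgrPdist_lt /(_ _ e0) := df.
move=> /nbhs_ballP [d /= d0 dP].
have [h [h0 hd hab]] : exists h, [/\ h != 0, `|h| < d & h + s \in `[a, b]].
  have [sm|ms] := leP s ((a + b) / 2).
    exists (Num.min (d / 2) ((b - a) / 2)).
    have p0 : 0 < Num.min (d / 2) ((b - a) / 2).
      by rewrite lt_min !divr_gt0// subr_gt0.
    rewrite gt_eqF// gtr0_norm//; split=> //.
      by rewrite gt_min ltr_pdivrMr// ltr_pMr// ltr1n.
    have : Num.min (d / 2) ((b - a) / 2) <= (b - a) / 2 by rewrite ge_min lexx orbT.
    move: sab p0; rewrite !in_itv/= => /andP[]; lra.
  exists (- Num.min (d / 2) ((b - a) / 2)).
  have p0 : 0 < Num.min (d / 2) ((b - a) / 2).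
    by rewrite lt_min !divr_gt0// subr_gt0.
  rewrite oppr_eq0 gt_eqF// normrN gtr0_norm//; split=> //.
    by rewrite gt_min ltr_pdivrMr// ltr_pMr// ltr1n.
  have : Num.min (d / 2) ((b - a) / 2) <= (b - a) / 2 by rewrite ge_min lexx orbT.
  move: sab p0; rewrite !in_itv/= => /andP[]; lra.
have := dP h; rewrite -ball_normE /ball_/= sub0r normrN => /(_ hd h0).
rewrite -/(derive f s 1) [h%:A]mulr1 (f0 _ hab) (f0 _ sab) subrr scaler0 subr0.
by rewrite ltxx.
Qed.

Lemma derive_segment a b f g s : a < b -> s \in `[a, b] ->
  (forall x, x \in `[a, b] -> f x = g x) ->
  derivable f s 1 -> derivable g s 1 -> 'D_1 f s = 'D_1 g s.
Proof.
move=> ab sab fg df dg; apply/eqP; rewrite -subr_eq0 -deriveB//; apply/eqP.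
apply: (derive_vanishing ab sab); last exact (derivableB df dg).
by move=> x /fg /=; rewrite !fctE => ->; rewrite subrr.
Qed.

Lemma continuous_integrable a b f : continuous f ->
  mu.-integrable `[a, b] (EFin \o f).
Proof.
move=> cf; apply: continuous_compact_integrable; first exact: segment_compact.
exact: continuous_subspaceT.
Qed.
Local Hint Resolve continuous_integrable : core.

Lemma is_derive_continuous F f : (forall s, is_derive s 1 F (f s)) ->
  continuous F.
Proof.
move=> dF s; apply: differentiable_continuous.
by apply/derivable1_diffP; have [] := dF s.
Qed.

(** The integral over [0, x] minus the one over [x, 0], one of which is empty.
    Near a given point it differs by a constant from the integral based at some
    a below both this point and 0, to which the fundamental theorem applies. *)
Lemma antiderivative f : continuous f ->
  exists2 F : R -> R, F 0 = 0 & forall s, is_derive s 1 F (f s).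
Proof.
move=> cf.
pose F (x : R) : R := \int[mu]_(t in `]0, x]) f t - \int[mu]_(t in `]x, 0]) f t.
exists F; first by rewrite /F set_itvoc0 !Rintegral_set0 subrr.
move=> s; pose a := Num.min s 0 - 1.
have [as_ a0] : a < s /\ a < 0.
  by rewrite /a !ltrBlDr !gt_min !ltrDl !ltr01 orbT.
pose G (x : R) : R := \int[mu]_(t in `[a, x]) f t.
have GF x : a < x -> G x - G 0 = F x.
  move=> ax; rewrite /G /F; have [x0|x0] := leP 0 x.
    rewrite (Rintegral_itvB (continuous_integrable _ _ cf))
      ?bnd_simp// ?ltW//.
    by rewrite (set_itv_ge (_ : ~~ (BRight x < BRight 0)%O)) ?Rintegral_set0
      ?subr0 // bnd_simp -leNgt.
  rewrite -[LHS]opprB (Rintegral_itvB (continuous_integrable _ _ cf))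
    ?bnd_simp// ?ltW//.
  rewrite (set_itv_ge (_ : ~~ (BRight 0 < BRight x)%O)) ?Rintegral_set0
      ?sub0r // bnd_simp -leNgt ltW //.
have [dG G's] : derivable G s 1 /\ G^`()%classic s = f s.
  apply: (@continuous_FTC1_closed _ f a s (s + 1)).
  - by rewrite ltrDl.
  - exact: continuous_integrable.
  - exact: as_.
  - exact: cf.
apply: (@near_eq_is_derive _ _ _ (fun x => G x - G 0)).
  near=> x; apply: GF; near: x; exact: lt_nbhsr.
have H : is_derive s 1 G (f s) by split; [exact: dG|rewrite -derive1E; exact: G's].
have := is_deriveB H (is_derive_cst (G 0) s 1); rewrite subr0; exact.
Unshelve. all: by end_near. Qed.

Lemma integral_antiderivative a b F f : a <= b -> continuous f ->
  (forall s, is_derive s 1 F (f s)) ->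
  \int[mu]_(s in `[a, b]) f s = F b - F a.
Proof.
move=> + cf dF; rewrite le_eqVlt => /predU1P[<-|ab].
  by rewrite set_itv1 Rintegral_set1 subrr.
have cF := is_derive_continuous dF.
rewrite /Rintegral (@continuous_FTC2 _ f F)//.
- exact: continuous_subspaceT.
- split=> [x _| |]; first by have [] := dF x.
  + by apply: cvg_at_right_filter; exact: cF.
  + by apply: cvg_at_left_filter; exact: cF.
- by move=> x _; rewrite derive1E; have [] := dF x.
Qed.

Lemma ge0_derive_homo a b F f : (forall s, is_derive s 1 F (f s)) ->
  (forall s, s \in `[a, b] -> 0 <= f s) ->
  {in `[a, b]%R &, {homo F : x y / x <= y >-> x <= y}}.
Proof.
move=> dF f0; apply: ger0_derive1_le_cc.
- by move=> x _; have [] := dF x.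
- move=> x xab; rewrite derive1E; have [_ ->] := dF x; apply: f0.
  exact: subset_itv_oo_cc.
- exact/continuous_subspaceT/is_derive_continuous.
Qed.

(** An antiderivative of f is nondecreasing with equal values at the ends, hence
    constant on the segment. *)
Lemma integral_ge0_eq0 a b f : a < b -> continuous f ->
  (forall s, s \in `[a, b] -> 0 <= f s) ->
  \int[mu]_(s in `[a, b]) f s = 0 -> forall s, s \in `[a, b] -> f s = 0.
Proof.
move=> ab cf f0 If s sab; have [F _ dF] := antiderivative cf.
have Fh := ge0_derive_homo dF f0.
have ain : a \in `[a, b] by rewrite in_itv/= lexx ltW.
have bin : b \in `[a, b] by rewrite in_itv/= lexx ltW.
have Fab : F b = F a.
  by apply/eqP; rewrite -subr_eq0 -(integral_antiderivative (ltW ab) cf dF) If.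
have Fcst x : x \in `[a, b] -> F x = cst (F a) x.
  move=> xab; have := xab; rewrite in_itv/= => /andP[ax xb].
  by apply/eqP; rewrite eq_le -[X in _ <= X]Fab !Fh.
have [dFs <-] := dF s.
by rewrite (derive_segment ab sab Fcst)// ?derive_cst//; exact (derivable_cst _ _ _).
Qed.

Lemma integral_dist a b f g (e : R) : a <= b -> continuous f -> continuous g ->
  (forall s, s \in `[a, b] -> `|f s - g s| <= e) ->
  `|\int[mu]_(s in `[a, b]) f s - \int[mu]_(s in `[a, b]) g s| <= e * (b - a).
Proof.
move=> ab cf cg fg; rewrite -RintegralB//; try exact: continuous_integrable.
have cfg : continuous (fun s => f s - g s).
  by move=> s; exact: (continuousB (cf s) (cg s)).
apply: (le_trans (le_normr_Rintegral _ _)) => //.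
  exact: (continuous_integrable a b cfg).
have -> : e * (b - a) = \int[mu]_(s in `[a, b]) e.
  rewrite Rintegral_cst// [X in fine X](lebesgue_measure_itv `[a, b])/= lte_fin.
  by move: ab; rewrite le_eqVlt => /predU1P[->|->//]; rewrite ltxx subrr.
apply: le_Rintegral => //.
- apply: (@continuous_integrable a b (fun s => `|f s - g s|)) => s.
  exact: (continuous_comp (cfg s) (@norm_continuous _ _ _)).
- by apply: (@continuous_integrable a b (fun=> e)) => s; exact: cst_continuous.
Qed.

End SegmentCalculus.

(** * Integrals depending on a parameter *)

Section ParameterIntegral.
Variables (R : realType) (V : normedModType R) (a b : R).
Hypothesis ab : a < b.
Implicit Types (Phi : R * V -> R) (s : R) (t v : V).
Local Notation mu := (@lebesgue_measure R).

Definition integral_over Phi t : R := \int[mu]_(s in `[a, b]) Phi (s, t).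

Lemma continuous_slice Phi t : continuous Phi -> continuous (fun s => Phi (s, t)).
Proof.
move=> cP s; apply: (@continuous_comp _ _ _ (fun s => (s, t)) Phi).
  exact: (cvg_pair cvg_id (cvg_cst t)).
exact: cP.
Qed.

(** Tube lemma: compactness of the segment makes continuity in the parameter
    uniform along it. *)
Lemma near_segment_uniform Phi t (e : R) : continuous Phi -> 0 < e ->
  \forall u \near t, forall s, s \in `[a, b] -> `|Phi (s, u) - Phi (s, t)| < e.
Proof.
move=> cP e0; have e20 : 0 < e / 2 by rewrite divr_gt0.
have /compact_near_coveringP cov := @segment_compact R a b.
pose P (u : V) (s : R) := `|Phi (s, u) - Phi (s, t)| < e.
suff /cov : forall s, `[a, b]%classic s ->
    \forall s' \near s & u \near nbhs t, P u s'.
  by apply: filterS => u Hu s /Hu.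
move=> s _; have /cvgrPdist_lt /(_ _ e20) [[A B] /= [nA nB] AB] := cP (s, t).
exists (A, B) => // -[s' u] [/= As' Bu]; rewrite /P.
have := ltrD (AB (s', u) (conj As' Bu)) (AB (s', t) (conj As' (nbhs_singleton nB))).
rewrite -splitr; apply: le_lt_trans => /=.
by rewrite [X in _ <= X + _]distrC; exact: ler_distD.
Qed.

Lemma continuous_integral_over Phi :
  continuous Phi -> continuous (integral_over Phi).
Proof.
move=> cP t; apply/cvgrPdist_le => e e0.
have d0 : 0 < e / (b - a) by rewrite divr_gt0// subr_gt0.
have := near_segment_uniform t cP d0; apply: filterS => u Hu.
rewrite distrC -(divfK (_ : b - a != 0) e) ?subr_eq0 ?gt_eqF//.
apply: integral_dist; [exact: ltW|exact: continuous_slice..|].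
by move=> s /Hu /ltW.
Qed.

Lemma is_derive_slice Phi s t v : derivable Phi (s, t) (0, v) ->
  is_derive t v (fun u => Phi (s, u)) ('D_(0, v) Phi (s, t)).
Proof.
have E : (fun h : R => h^-1 *: (((fun u => Phi (s, u)) \o shift t) (h *: v)
     - Phi (s, t))) =
  (fun h : R => h^-1 *: ((Phi \o shift (s, t)) (h *: ((0, v) : R * V)) - Phi (s, t))).
  apply/funext => h /=; congr (_ *: (Phi _ - _)).
  by congr (_, _); rewrite /= scaler0 add0r.
by move=> dP; split; [rewrite /derivable E|rewrite /derive E].
Qed.

Lemma is_derive_slice_fst Phi s t w : derivable Phi (s, t) (w, 0) ->
  is_derive s w (fun r => Phi (r, t)) ('D_(w, 0) Phi (s, t)).
Proof.
have E : (fun h : R => h^-1 *: (((fun r => Phi (r, t)) \o shift s) (h *: w)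
     - Phi (s, t))) =
  (fun h : R => h^-1 *: ((Phi \o shift (s, t)) (h *: ((w, 0) : R * V)) - Phi (s, t))).
  apply/funext => h /=; congr (_ *: (Phi _ - _)).
  by congr (_, _); rewrite /= scaler0 add0r.
by move=> dP; split; [rewrite /derivable E|rewrite /derive E].
Qed.

(** By the mean value theorem, the difference quotient of the integrand at s is
    a derivative at some (s, t + c v) with c small, uniformly close to the one
    at (s, t). *)
Lemma is_derive_integral_over Phi t v : continuous Phi ->
  (forall x, derivable Phi x (0, v)) -> continuous ('D_(0, v) Phi) ->
  is_derive t v (integral_over Phi) (integral_over ('D_(0, v) Phi) t).
Proof.
move=> cP dP cD.
suff H : h^-1 *: ((integral_over Phi \o shift t) (h *: v) - integral_over Phi t)
    @[h --> 0^'] --> integral_over ('D_(0, v) Phi) t.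
  by split; [apply/cvg_ex; eexists; exact: H|exact: cvg_lim H].
apply/cvgrPdist_le => e e0.
have d0 : 0 < e / (b - a) by rewrite divr_gt0// subr_gt0.
have /nbhs_ballP[r /= r0 Hr] := near_segment_uniform t cD d0.
have N0 : 0 < `|v| + 1 by rewrite ltr_wpDl.
apply/nbhs_ballP; exists (r / (`|v| + 1)); first exact: divr_gt0.
move=> h; rewrite -ball_normE /ball_/= sub0r normrN => hr h0.
have cq u : continuous (fun s => Phi (s, u)) by exact: continuous_slice.
have cB : continuous (fun s => Phi (s, h *: v + t) - Phi (s, t)).
  by move=> s; exact: (continuousB (cq _ s) (cq _ s)).
have -> : h^-1 *: (integral_over Phi (h *: v + t) - integral_over Phi t) =
    \int[mu]_(s in `[a, b]) (h^-1 * (Phi (s, h *: v + t) - Phi (s, t))).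
  rewrite RintegralZl//; last exact: (continuous_integrable a b cB).
  by rewrite RintegralB//; exact: continuous_integrable.
rewrite -(divfK (_ : b - a != 0) e) ?subr_eq0 ?gt_eqF//.
apply: integral_dist; [exact: ltW| | |].
  by apply: (continuous_slice (Phi := derive Phi ^~ (0, v))); exact: cD.
  by move=> s; exact: (continuousM (@cst_continuous _ _ h^-1 s) (cB s)).
move=> s sab.
have [c ch E] := mean_value_line t h
  (fun u => @ex_derive _ _ _ _ _ _ _ (is_derive_slice (dP (s, u)))).
rewrite [h *: v + t]addrC E mulrA mulVf// mul1r distrC.
rewrite (@derive_val _ _ _ _ _ _ _ (is_derive_slice (dP _))).
apply/ltW/Hr => //; rewrite -ball_normE /ball_/= opprD addNKr normrN normrZ.
apply: (@le_lt_trans _ _ (`|h| * (`|v| + 1))).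
  by rewrite ler_pM// lerDl.
by rewrite -ltr_pdivlMr.
Qed.

(** Derivatives along the parameter pass under the integral sign, so the
    integral inherits every order of differentiability. *)
Lemma smooth_integral_over Phi : smooth Phi -> smooth (integral_over Phi).
Proof.
move=> sP k; elim: k Phi sP => [|k IHk] Phi sP.
  exact/continuous_integral_over/smooth_continuous.
have dI t v : is_derive t v (integral_over Phi) (integral_over ('D_(0, v) Phi) t).
  apply: is_derive_integral_over; first exact: smooth_continuous.
  - by move=> x; exact: smooth_derivable.
  - exact/smooth_continuous/smooth_derive.
split=> [|t v|v].
- exact/continuous_integral_over/smooth_continuous.
- by have [] := dI t v.
- under eq_fun do rewrite (@derive_val _ _ _ _ _ _ _ (dI _ v)).
  exact/IHk/smooth_derive.
Qed.

End ParameterIntegral.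

(** * Two by two complex matrices in Pauli coordinates *)

Section TwoByTwo.
Variable F : comPzRingType.
Implicit Types A B : 'M[F]_2.

Lemma ord2_ind (P : 'I_2 -> Prop) : P 0 -> P 1 -> forall i, P i.
Proof.
by move=> P0 P1 [[|[|//]] ?]; [move: P0|move: P1]; congr P; exact: val_inj.
Qed.

Lemma sum_ord2 (f : 'I_2 -> F) : \sum_i f i = f 0 + f 1.
Proof.
rewrite !big_ord_recl big_ord0 addr0; congr (_ + f _); exact: val_inj.
Qed.

Lemma mulmx2E A B i j : (A *m B) i j = A i 0 * B 0 j + A i 1 * B 1 j.
Proof. by rewrite mxE sum_ord2. Qed.

Lemma mxtrace2E A : \tr A = A 0 0 + A 1 1.
Proof. by rewrite /mxtrace sum_ord2. Qed.

Lemma det2E A : \det A = A 0 0 * A 1 1 - A 0 1 * A 1 0.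
Proof.
rewrite (expand_det_row _ 0) sum_ord2 /cofactor !det_mx11 !mxE /=.
have -> : lift (0 : 'I_2) (0 : 'I_1) = 1 by exact: val_inj.
have -> : lift (1 : 'I_2) (0 : 'I_1) = 0 by exact: val_inj.
by rewrite expr0 mul1r expr1 mulN1r mulrN.
Qed.

(** The adjugate; for 2 x 2 matrices, Cayley-Hamilton makes it linear in A. *)
Definition adj2 A : 'M[F]_2 := (\tr A)%:M - A.

Lemma mul_adj2 A : adj2 A *m A = (\det A)%:M.
Proof.
apply/matrixP; apply: ord2_ind; apply: ord2_ind;
  rewrite mulmx2E !mxE mxtrace2E det2E /= ?mulr1n ?mulr0n; ring.
Qed.

Lemma mulmx_adj2 A : A *m adj2 A = (\det A)%:M.
Proof.
apply/matrixP; apply: ord2_ind; apply: ord2_ind;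
  rewrite mulmx2E !mxE mxtrace2E det2E /= ?mulr1n ?mulr0n; ring.
Qed.
End TwoByTwo.

Lemma invmx_adj2 (F : fieldType) (A : 'M[F]_2) :
  invmx A = if \det A == 0 then A else (\det A)^-1 *: adj2 A.
Proof.
have [d0|d0] := eqVneq (\det A) 0.
  by rewrite /invmx unitmxE d0 unitr0.
have uA : A \in unitmx by rewrite unitmxE unitfE.
have -> : adj2 A = \det A *: invmx A.
  by rewrite -[LHS]mulmx1 -(mulmxV uA) mulmxA mul_adj2 mul_scalar_mx.
by rewrite scalerA mulVf// scale1r.
Qed.

Section ComplexParts.
Variable R : rcfType.
Implicit Types y z : R[i].

Lemma complex_eq y z :
  complex.Re y = complex.Re z -> complex.Im y = complex.Im z -> y = z.
Proof. by case: y z => [a b] [c d] /= -> ->. Qed.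

Lemma Re_addc y z : complex.Re (y + z) = complex.Re y + complex.Re z.
Proof. by case: y z => [a b] [c d]. Qed.
Lemma Im_addc y z : complex.Im (y + z) = complex.Im y + complex.Im z.
Proof. by case: y z => [a b] [c d]. Qed.
Lemma Re_oppc z : complex.Re (- z) = - complex.Re z. Proof. by case: z. Qed.
Lemma Im_oppc z : complex.Im (- z) = - complex.Im z. Proof. by case: z. Qed.
Lemma Re_mulc y z : complex.Re (y * z) =
  complex.Re y * complex.Re z - complex.Im y * complex.Im z.
Proof. by case: y z => [a b] [c d]. Qed.
Lemma Im_mulc y z : complex.Im (y * z) =
  complex.Re y * complex.Im z + complex.Im y * complex.Re z.
Proof. by case: y z => [a b] [c d]. Qed.
Lemma Re_natc n : complex.Re (n%:R : R[i]) = n%:R.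
Proof. by elim: n => // n IHn; rewrite !mulrS Re_addc IHn. Qed.
Lemma Im_natc n : complex.Im (n%:R : R[i]) = 0.
Proof. by elim: n => // n IHn; rewrite !mulrS Im_addc IHn addr0. Qed.
Definition ReImE := (Re_addc, Im_addc, Re_oppc, Im_oppc, Re_mulc, Im_mulc, Re_natc, Im_natc).
End ComplexParts.

Section PauliCoordinates.
Variable R : realType.
Local Notation M2 := 'M[R[i]]_2.
Implicit Types A B C : M2.

(** Coordinates of the traceless Hermitian matrix with first row
    (x1, x2 + i x3), read off any matrix. *)
Definition x1 A := complex.Re (A 0 0).
Definition x2 A := complex.Re (A 0 1).
Definition x3 A := complex.Im (A 0 1).

Definition pauli (a b c : R) : M2 := \matrix_(i, j)
  if i == 0 then if j == 0 then a%:C else b +i* c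
  else if j == 0 then b -i* c else (- a)%:C.

Lemma x1_pauli a b c : x1 (pauli a b c) = a. Proof. by rewrite /x1 mxE. Qed.
Lemma x2_pauli a b c : x2 (pauli a b c) = b. Proof. by rewrite /x2 mxE. Qed.
Lemma x3_pauli a b c : x3 (pauli a b c) = c. Proof. by rewrite /x3 mxE. Qed.
Definition x_pauli := (x1_pauli, x2_pauli, x3_pauli).

Lemma herm0_pauli a b c : herm0 (pauli a b c).
Proof.
split; last by rewrite mxtrace2E !mxE /=; apply/eqP; rewrite eq_complex /= subrr addr0 eqxx.
apply/matrixP; apply: ord2_ind; apply: ord2_ind; rewrite !mxE /=; congr (_ +i* _).
all: by rewrite ?oppr0 ?opprK.
Qed.

Lemma herm0E A : herm0 A -> A = pauli (x1 A) (x2 A) (x3 A).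
Proof.
move=> [/matrixP hA /eqP]; rewrite mxtrace2E addrC addr_eq0 => /eqP trA.
have h00 := hA 0 0; have h10 := hA 1 0; rewrite !mxE in h00 h10.
have A00 : A 0 0 = (x1 A)%:C.
  move: h00; rewrite /x1; case: (A 0 0) => a b [/eqP].
  by rewrite eq_sym -addr_eq0 -mulr2n mulrn_eq0/= => /eqP ->.
apply/matrixP; apply: ord2_ind; apply: ord2_ind; rewrite !mxE/=.
- exact: A00.
- by rewrite /x2 /x3; case: (A 0 1).
- by rewrite -h10 /x2 /x3; case: (A 0 1).
- by rewrite trA A00; congr (_ +i* _); rewrite oppr0.
Qed.

Definition dot A B : R := x1 A * x1 B + x2 A * x2 B + x3 A * x3 B.
Definition cross A B : M2 := pauli (x2 A * x3 B - x3 A * x2 B)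
  (x3 A * x1 B - x1 A * x3 B) (x1 A * x2 B - x2 A * x1 B).
(** Only the coordinates of the arguments enter, so [vol] is defined for all
    matrices; it is meant for traceless Hermitian ones. *)
Definition vol A B C : R := dot A (cross B C).

Lemma pauliD a b c a' b' c' :
  pauli a b c + pauli a' b' c' = pauli (a + a') (b + b') (c + c').
Proof.
apply/matrixP; apply: ord2_ind; apply: ord2_ind; rewrite !mxE /=;
  by apply: complex_eq; rewrite /= ?addr0 ?opprD.
Qed.

Lemma dotDr A B C : herm0 B -> herm0 C -> dot A (B + C) = dot A B + dot A C.
Proof.
by move=> /herm0E -> /herm0E ->; rewrite pauliD /dot !x_pauli; ring.
Qed.

Lemma pairing_dot A B : herm0 A -> herm0 B -> pairing A B = (4 * dot A B)%:C.
Proof.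
move=> /herm0E -> /herm0E ->; rewrite /pairing mxtrace2E !mulmx2E /dot !x_pauli !mxE /=.
by apply: complex_eq; rewrite !ReImE /=; ring.
Qed.

(** In these coordinates the commutator is the vector product, as on
    Pauli matrices. *)
Lemma bracket_cross B C : herm0 B -> herm0 C ->
  bracket B C = (0 +i* 2) *: cross B C.
Proof.
move=> /herm0E -> /herm0E ->; rewrite /bracket /cross !x_pauli.
move: (x1 B) (x2 B) (x3 B) (x1 C) (x2 C) (x3 C) => b1 b2 b3 c1 c2 c3.
apply/matrixP; apply: ord2_ind; apply: ord2_ind; rewrite !mxE !sum_ord2 !mxE;
  by apply: complex_eq; rewrite !ReImE /=; ring.
Qed.

Lemma pairing_bracket A B C : herm0 A -> herm0 B -> herm0 C ->
  pairing A (bracket B C) = 0 +i* (8 * vol A B C).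
Proof.
move=> hA hB hC; rewrite bracket_cross// /pairing -scalemxAr mxtraceZ mulrCA.
rewrite -/(pairing _ _) pairing_dot//; last exact: herm0_pauli.
by apply: complex_eq; rewrite !ReImE /= /vol; ring.
Qed.

Lemma volC A B C : vol A C B = - vol A B C.
Proof. by rewrite /vol /dot /cross !x_pauli; ring. Qed.

Lemma vol_cross A B : vol A B (cross A B) = dot A A * dot B B - dot A B ^+ 2.
Proof. by rewrite /vol /dot /cross !x_pauli; ring. Qed.

Lemma dot_crossl A B : dot A (cross A B) = 0.
Proof. by rewrite /dot /cross !x_pauli; ring. Qed.

(** Three vectors orthogonal to a fourth one lie in a plane. *)
Lemma vol_orthogonal L A B C : dot L A = 0 -> dot L B = 0 -> dot L C = 0 ->
  dot L L * vol A B C = 0.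
Proof.
move=> LA LB LC.
have -> : dot L L * vol A B C =
    dot L A * vol L B C + dot L B * vol A L C + dot L C * vol A B L.
  by rewrite /vol /dot /cross !x_pauli; ring.
by rewrite LA LB LC !mul0r !addr0.
Qed.

Lemma herm0_dot_eq0 A : herm0 A -> dot A A = 0 -> A = 0.
Proof.
move=> hA; rewrite /dot -!expr2 => /eqP.
rewrite !paddr_eq0 ?sqrf_eq0 ?addr_ge0 ?sqr_ge0//.
move=> /andP[/andP[/eqP a0 /eqP b0] /eqP c0].
rewrite (herm0E hA) a0 b0 c0.
apply/matrixP; apply: ord2_ind; apply: ord2_ind; rewrite !mxE /=;
 congr (_ +i* _); exact: oppr0.
Qed.

Lemma pauliZD (k a b c a' b' c' : R) :
  k%:C *: pauli a b c + pauli a' b' c' =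
  pauli (k * a + a') (k * b + b') (k * c + c').
Proof.
apply/matrixP; apply: ord2_ind; apply: ord2_ind; rewrite !mxE /=;
  apply: complex_eq; rewrite !ReImE /=; ring.
Qed.

Lemma herm0_lin (k : R) A B :
  herm0 A -> herm0 B -> herm0 (k%:C *: A + B).
Proof. by move=> /herm0E -> /herm0E ->; rewrite pauliZD; exact: herm0_pauli. Qed.

Lemma vol_lin (k : R) A B B' C :
  herm0 B -> herm0 B' ->
  vol A (k%:C *: B + B') C = k * vol A B C + vol A B' C.
Proof.
move=> /herm0E -> /herm0E ->; rewrite pauliZD /vol /dot /cross !x_pauli.
by ring.
Qed.

Lemma dotC A B :
  dot A B = dot B A.
Proof. by rewrite /dot; ring. Qed.

(** The exterior derivative at one instant: a, b, c stand for the first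
    derivatives of a curve l on the sphere in three parameters, ab, bc, ac for
    the second ones. *)
Lemma cyclic_vol (l a b c ab bc ac : M2) :
  vol a b c = 0 ->
  8 * (vol a b c + vol l ab c + vol l b ac)
    + 8 * (vol b c a + vol l bc a + vol l c ab)
    + 8 * (vol c a b + vol l ac b + vol l a bc) = 0.
Proof.
have rot u v w : vol v w u = vol u v w :> R.
  by rewrite /vol /dot /cross !x_pauli; ring.
move=> abc; rewrite (rot b c a) (rot a b c) abc.
rewrite (volC l ab c) (volC l bc a) (volC l ac b); ring.
Qed.

(** The covariant derivative of w = g^-1 v, computed from g l = g', is the
    variation d of l. Here v l + g d is the mixed second derivative, so the
    first summand is w' and the second one is [w, l]. *)
Lemma bracket_variation (g v l d : M2) :
  g \in unitmx ->
  invmx g *m (v *m l + g *m d - g *m l *m (invmx g *m v))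
    + bracket (invmx g *m v) l = d.
Proof.
move=> ug; rewrite /bracket mulmxBr mulmxDr.
rewrite (mulKmx ug) -(mulmxA g l) (mulKmx ug) mulmxA.
by rewrite addrA subrK addrAC subrr add0r.
Qed.

End PauliCoordinates.

(** * Derivatives of matrix-valued functions *)

Section ComplexCalculus.
Variables (R : realType) (V : normedModType R).
Implicit Types (f g : V -> R[i]) (x v : V).

Definition smoothc f :=
  smooth (fun x => complex.Re (f x)) /\ smooth (fun x => complex.Im (f x)).

Definition derivablec f x v :=
  derivable (fun y => complex.Re (f y)) x v /\
  derivable (fun y => complex.Im (f y)) x v.

Definition derivec v f x : R[i] :=
  'D_v (fun y => complex.Re (f y)) x +i* 'D_v (fun y => complex.Im (f y)) x.

Lemma smoothc_derivable f x v : smoothc f -> derivablec f x v.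
Proof. by move=> [sr si]; split; exact: smooth_derivable. Qed.

Lemma smoothcD f g : smoothc f -> smoothc g -> smoothc (fun x => f x + g x).
Proof.
move=> [fr fi] [gr gi]; split.
- by under eq_fun do rewrite Re_addc; exact: smoothD.
- by under eq_fun do rewrite Im_addc; exact: smoothD.
Qed.

Lemma smoothcM f g : smoothc f -> smoothc g -> smoothc (fun x => f x * g x).
Proof.
move=> [fr fi] [gr gi]; split.
- by under eq_fun do rewrite Re_mulc; apply: smoothB; exact: smoothM.
- by under eq_fun do rewrite Im_mulc; apply: smoothD; exact: smoothM.
Qed.

Lemma derivablecD f g x v : derivablec f x v -> derivablec g x v ->
  derivablec (fun y => f y + g y) x v.
Proof.
move=> [fr fi] [gr gi]; split.
- under eq_fun do rewrite Re_addc; exact (derivableD fr gr).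
- under eq_fun do rewrite Im_addc; exact (derivableD fi gi).
Qed.

Lemma derivecD f g x v : derivablec f x v -> derivablec g x v ->
  derivec v (fun y => f y + g y) x = derivec v f x + derivec v g x.
Proof.
move=> [fr fi] [gr gi]; apply: complex_eq; rewrite ReImE /=.
- by under eq_fun do rewrite Re_addc; exact: (deriveDE fr gr).
- by under eq_fun do rewrite Im_addc; exact: (deriveDE fi gi).
Qed.

Lemma derivablecM f g x v : derivablec f x v -> derivablec g x v ->
  derivablec (fun y => f y * g y) x v.
Proof.
move=> [fr fi] [gr gi]; split.
- under eq_fun do rewrite Re_mulc.
  exact (derivableB (derivableM fr gr) (derivableM fi gi)).
- under eq_fun do rewrite Im_mulc.
  exact (derivableD (derivableM fr gi) (derivableM fi gr)).
Qed.

Lemma derivecM f g x v : derivablec f x v -> derivablec g x v ->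
  derivec v (fun y => f y * g y) x = derivec v f x * g x + f x * derivec v g x.
Proof.
move=> [fr fi] [gr gi]; apply: complex_eq; rewrite !ReImE /=.
- under eq_fun do rewrite Re_mulc.
  rewrite (deriveBE (derivableM fr gr) (derivableM fi gi)).
  by rewrite (deriveME fr gr) (deriveME fi gi); ring.
- under eq_fun do rewrite Im_mulc.
  rewrite (deriveDE (derivableM fr gi) (derivableM fi gr)).
  by rewrite (deriveME fr gi) (deriveME fi gr); ring.
Qed.

(** Complex inversion is differentiated through z^-1 = conj z / |z|^2. *)
Lemma derivablecV f x v : f x != 0 -> derivablec f x v ->
  derivablec (fun y => (f y)^-1) x v.
Proof.
move=> fx0 [fr fi].
pose n y := complex.Re (f y) * complex.Re (f y) + complex.Im (f y) * complex.Im (f y).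
have dn : derivable n x v by exact (derivableD (derivableM fr fr) (derivableM fi fi)).
have n0 : n x != 0.
  rewrite /n -!expr2 paddr_eq0 ?sqr_ge0// !sqrf_eq0.
  by apply: contra fx0 => /andP[/eqP a /eqP b]; apply/eqP/complex_eq.
have dV := derivableV n0 dn.
split.
- rewrite (_ : (fun y => _) = (fun y => complex.Re (f y) * (n y)^-1)).
    exact (derivableM fr dV).
  by apply/funext => y; rewrite /n; case: (f y) => a b /=; rewrite !expr2.
- rewrite (_ : (fun y => _) = (fun y => - (complex.Im (f y) * (n y)^-1))).
    exact (derivableN (derivableM fi dV)).
  by apply/funext => y; rewrite /n; case: (f y) => a b /=; rewrite !expr2.
Qed.

End ComplexCalculus.

Section MatrixCalculus.
Variables (R : realType) (V : normedModType R).
Local Notation M2 := 'M[R[i]]_2.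
Implicit Types (F G : V -> M2) (x v : V).

Definition derivable_mx F x v := forall i j, derivablec (fun y => F y i j) x v.

Lemma smooth_mx_derivable F x v : smooth_mx F -> derivable_mx F x v.
Proof. by move=> sF i j; exact: smoothc_derivable. Qed.

Lemma D_mxE v F x i j : D_mx v F x i j = derivec v (fun y => F y i j) x.
Proof. by rewrite mxE. Qed.

Lemma smooth_D_mx v F : smooth_mx F -> smooth_mx (D_mx v F).
Proof.
move=> sF i j; split; under eq_fun do rewrite D_mxE.
- exact: smooth_derive (sF i j).1.
- exact: smooth_derive (sF i j).2.
Qed.

Lemma smooth_mxM F G : smooth_mx F -> smooth_mx G -> smooth_mx (fun x => F x *m G x).
Proof.
move=> sF sG i j; rewrite -/(smoothc (fun x => (F x *m G x) i j)).
under eq_fun do rewrite mulmx2E.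
by apply: smoothcD; (apply: smoothcM; [exact: sF|exact: sG]).
Qed.

Lemma derivable_mxM F G x v : derivable_mx F x v -> derivable_mx G x v ->
  derivable_mx (fun x => F x *m G x) x v.
Proof.
move=> dF dG i j.
by under eq_fun do rewrite mulmx2E; apply: derivablecD; apply: derivablecM.
Qed.

Lemma D_mxM F G x v : derivable_mx F x v -> derivable_mx G x v ->
  D_mx v (fun x => F x *m G x) x = D_mx v F x *m G x + F x *m D_mx v G x.
Proof.
move=> dF dG; apply/matrixP => i j; rewrite D_mxE mxE !mulmx2E !D_mxE.
under eq_fun do rewrite mulmx2E.
rewrite derivecD; [|exact: derivablecM..].
by rewrite !derivecM//; ring.
Qed.

Lemma smooth_mx_adj2 F : smooth_mx F -> smooth_mx (fun x => adj2 (F x)).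
Proof.
move=> sF i j; rewrite -/(smoothc (fun x => adj2 (F x) i j)).
have adjE x : adj2 (F x) i j = (i == j)%:R * (F x 0 0 + F x 1 1) + (-1) * F x i j.
  by rewrite !mxE mxtrace2E mulr_natl mulN1r.
under eq_fun do rewrite adjE.
have sc (c : R[i]) : smoothc (fun _ : V => c) by split; exact: smooth_cst.
by apply: smoothcD; apply: smoothcM => //; apply: smoothcD; exact: sF.
Qed.

Lemma smooth_mx_pauli (a b c : V -> R) : smooth a -> smooth b -> smooth c ->
  smooth_mx (fun x => pauli (a x) (b x) (c x)).
Proof.
move=> sa sb sc; apply: ord2_ind; apply: ord2_ind; split;
  under eq_fun do rewrite mxE /=; rewrite ?oppr0 => //; try exact: smooth_cst; exact: smoothN.
Qed.

Lemma smooth_x1 F : smooth_mx F -> smooth (fun x => x1 (F x)).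
Proof. by move=> sF; exact: (sF 0 0).1. Qed.
Lemma smooth_x2 F : smooth_mx F -> smooth (fun x => x2 (F x)).
Proof. by move=> sF; exact: (sF 0 1).1. Qed.
Lemma smooth_x3 F : smooth_mx F -> smooth (fun x => x3 (F x)).
Proof. by move=> sF; exact: (sF 0 1).2. Qed.

Lemma x1_D_mx v F x : x1 (D_mx v F x) = 'D_v (fun y => x1 (F y)) x.
Proof. by rewrite /x1 mxE. Qed.
Lemma x2_D_mx v F x : x2 (D_mx v F x) = 'D_v (fun y => x2 (F y)) x.
Proof. by rewrite /x2 mxE. Qed.
Lemma x3_D_mx v F x : x3 (D_mx v F x) = 'D_v (fun y => x3 (F y)) x.
Proof. by rewrite /x3 mxE. Qed.
Definition x_D_mx := (x1_D_mx, x2_D_mx, x3_D_mx).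

Lemma D_mx_pauli v (a b c : V -> R) x :
  derivable a x v -> derivable b x v -> derivable c x v ->
  D_mx v (fun x => pauli (a x) (b x) (c x)) x =
  pauli ('D_v a x) ('D_v b x) ('D_v c x).
Proof.
have dN (f : V -> R) : derivable f x v -> 'D_v (fun y => - f y) x = - 'D_v f x.
  exact: deriveN.
have d0 (k : R) : 'D_v (fun _ : V => k) x = 0 by exact: derive_cst.
move=> da db dc; apply/matrixP; apply: ord2_ind; apply: ord2_ind;
  rewrite D_mxE mxE /derivec /=;
  apply: complex_eq; rewrite /=; under eq_fun do rewrite mxE /=;
  by rewrite ?d0 ?dN.
Qed.

Lemma Re_D_mx v F i j : (fun x => complex.Re (D_mx v F x i j)) =
  (fun x => 'D_v (fun y => complex.Re (F y i j)) x).
Proof. by apply/funext => x; rewrite D_mxE. Qed.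

Lemma Im_D_mx v F i j : (fun x => complex.Im (D_mx v F x i j)) =
  (fun x => 'D_v (fun y => complex.Im (F y i j)) x).
Proof. by apply/funext => x; rewrite D_mxE. Qed.

Lemma D_mx_comm u v F x : smooth_mx F ->
  D_mx u (D_mx v F) x = D_mx v (D_mx u F) x.
Proof.
move=> sF; apply/matrixP => i j; rewrite [LHS]D_mxE [RHS]D_mxE /derivec.
(* fu and fv are abstract, since matrix entries equal these derivatives
   only propositionally *)
have comm f : smooth f -> forall fu fv, fu = (fun y => 'D_u f y) ->
    fv = (fun y => 'D_v f y) -> 'D_u fv x = 'D_v fu x.
  by move=> sf _ _ -> ->; exact: derive_comm (sf 2).
apply: (f_equal2 (@Complex R)).
- exact: comm (sF i j).1 _ _ (Re_D_mx u F i j) (Re_D_mx v F i j).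
- exact: comm (sF i j).2 _ _ (Im_D_mx u F i j) (Im_D_mx v F i j).
Qed.

Lemma D_mx_lin (k : R) F G x v :
  derivable_mx F x v -> derivable_mx G x v ->
  D_mx v (fun y => k%:C *: F y + G y) x = k%:C *: D_mx v F x + D_mx v G x.
Proof.
move=> dF dG; apply/matrixP => i j; rewrite [LHS]D_mxE [RHS]mxE [in RHS]mxE.
rewrite (D_mxE v F) (D_mxE v G).
have dk : derivablec (fun _ : V => k%:C) x v by split; exact (derivable_cst _ _ _).
have -> : (fun y => (k%:C *: F y + G y) i j) = (fun y => k%:C * F y i j + G y i j).
  by apply/funext => y; rewrite !mxE.
rewrite (derivecD (derivablecM dk (dF i j)) (dG i j)).
rewrite (derivecM dk (dF i j)); congr (_ + _).
have -> : derivec v (fun _ : V => k%:C) x = 0.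
  have d0 (c : R) : 'D_v (fun _ : V => c) x = 0 by exact: derive_cst.
  by rewrite /derivec !d0.
by rewrite mul0r add0r.
Qed.

Lemma near_eq_D_mx v F G x : (\near x, F x = G x) -> D_mx v F x = D_mx v G x.
Proof.
move=> FG; apply/matrixP => i j; rewrite !D_mxE; congr (_ +i* _);
  by apply: near_eq_derive; apply: filterS FG => y ->.
Qed.

Lemma derive_dot F G x v : smooth_mx F -> smooth_mx G ->
  'D_v (fun y : V => dot (F y) (G y)) x = dot (D_mx v F x) (G x) + dot (F x) (D_mx v G x).
Proof.
move=> sF sG.
have [sF1 sF2 sF3] := And3 (smooth_x1 sF) (smooth_x2 sF) (smooth_x3 sF).
have [sG1 sG2 sG3] := And3 (smooth_x1 sG) (smooth_x2 sG) (smooth_x3 sG).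
rewrite /dot !x_D_mx !deriveDE ?deriveME.
  by ring.
all: apply: smooth_derivable; do ?[apply: smoothD|apply: smoothM] => //.
Qed.

Lemma smooth_dot F G : smooth_mx F -> smooth_mx G -> smooth (fun x => dot (F x) (G x)).
Proof.
move=> sF sG; apply: smoothD; [apply: smoothD|]; apply: smoothM;
 by [exact: smooth_x1|exact: smooth_x2|exact: smooth_x3].
Qed.

Lemma smooth_cross F G : smooth_mx F -> smooth_mx G ->
  smooth_mx (fun x => cross (F x) (G x)).
Proof.
move=> sF sG; apply: smooth_mx_pauli; apply: smoothB; apply: smoothM;
 by [exact: smooth_x1|exact: smooth_x2|exact: smooth_x3].
Qed.

Lemma D_mx_cross F G x v : smooth_mx F -> smooth_mx G ->
  D_mx v (fun y => cross (F y) (G y)) x =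
  cross (D_mx v F x) (G x) + cross (F x) (D_mx v G x).
Proof.
move=> sF sG.
have [sF1 sF2 sF3] := And3 (smooth_x1 sF) (smooth_x2 sF) (smooth_x3 sF).
have [sG1 sG2 sG3] := And3 (smooth_x1 sG) (smooth_x2 sG) (smooth_x3 sG).
have dM (f g h k : V -> R) : smooth f -> smooth g -> smooth h -> smooth k ->
    is_derive x v (fun y => f y * g y - h y * k y)
      ('D_v f x * g x - h x * 'D_v k x + (f x * 'D_v g x - 'D_v h x * k x)).
  move=> sf sg sh sk; split.
    by apply: smooth_derivable; apply: smoothB; apply: smoothM.
  rewrite deriveBE; [|exact/smooth_derivable/smoothM..].
  by rewrite !deriveME; [ring|exact: smooth_derivable..].
have d1 := dM _ _ _ _ sF2 sG3 sF3 sG2.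
have d2 := dM _ _ _ _ sF3 sG1 sF1 sG3.
have d3 := dM _ _ _ _ sF1 sG2 sF2 sG1.
rewrite D_mx_pauli; [|exact: ex_derive..].
rewrite (@derive_val _ _ _ _ _ _ _ d1) (@derive_val _ _ _ _ _ _ _ d2).
rewrite (@derive_val _ _ _ _ _ _ _ d3) /cross pauliD !x_D_mx.
congr pauli; ring.
Qed.

Lemma smooth_vol F G H : smooth_mx F -> smooth_mx G -> smooth_mx H ->
  smooth (fun x => vol (F x) (G x) (H x)).
Proof. by move=> sF sG sH; apply: smooth_dot => //; exact: smooth_cross. Qed.

Lemma derive_vol F G H x v : smooth_mx F -> smooth_mx G -> smooth_mx H ->
  'D_v (fun y => vol (F y) (G y) (H y)) x =
  vol (D_mx v F x) (G x) (H x) + vol (F x) (D_mx v G x) (H x)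
    + vol (F x) (G x) (D_mx v H x).
Proof.
move=> sF sG sH; rewrite derive_dot//; last exact: smooth_cross.
by rewrite D_mx_cross// dotDr ?addrA//; exact: herm0_pauli.
Qed.

End MatrixCalculus.

(** * Slices of functions on a product *)

Section Slices.
Variables (R : realType) (V : normedModType R).
Local Notation M2 := 'M[R[i]]_2.
Implicit Types (H : R * V -> M2) (s : R) (t v : V).

Lemma is_derivec_slice H s t v i j : smooth_mx H ->
  derivablec (fun u => H (s, u) i j) t v /\
  derivec v (fun u => H (s, u) i j) t = derivec (0, v) (fun p => H p i j) (s, t).
Proof.
move=> sH; have [sRe sIm] := sH i j.
have [dRe eRe] := is_derive_slice (smooth_derivable (x := (s, t)) (v := (0, v)) sRe).
have [dIm eIm] := is_derive_slice (smooth_derivable (x := (s, t)) (v := (0, v)) sIm).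
split; [exact (conj dRe dIm)|exact (f_equal2 (@Complex R) eRe eIm)].
Qed.

Lemma is_derivec_slice_fst H s t i j : smooth_mx H ->
  derivablec (fun r : R => H (r, t) i j) s 1 /\
  derivec (1 : R) (fun r : R => H (r, t) i j) s =
    derivec ((1, 0) : R * V) (fun p => H p i j) (s, t).
Proof.
move=> sH; have [sRe sIm] := sH i j.
have [dRe eRe] := is_derive_slice_fst (smooth_derivable (x := (s, t)) (v := ((1, 0) : R * V)) sRe).
have [dIm eIm] := is_derive_slice_fst (smooth_derivable (x := (s, t)) (v := ((1, 0) : R * V)) sIm).
split; [exact (conj dRe dIm)|exact (f_equal2 (@Complex R) eRe eIm)].
Qed.

Lemma derivable_mx_slice H s t v : smooth_mx H ->
  derivable_mx (fun u => H (s, u)) t v.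
Proof. by move=> sH i j; have [] := is_derivec_slice s t v i j sH. Qed.

Lemma D_mx_slice H s t v : smooth_mx H ->
  D_mx v (fun u => H (s, u)) t = D_mx (0, v) H (s, t).
Proof.
move=> sH; apply/matrixP => i j; rewrite [LHS]D_mxE [RHS]D_mxE.
by have [] := is_derivec_slice s t v i j sH.
Qed.

Lemma derivable_mx_slice_fst H s t : smooth_mx H ->
  derivable_mx (V := R) (fun r => H (r, t)) s 1.
Proof. by move=> sH i j; have [] := is_derivec_slice_fst s t i j sH. Qed.

Lemma ddt_slice H s t : smooth_mx H ->
  ddt (fun r => H (r, t)) s = D_mx ((1, 0) : R * V) H (s, t).
Proof.
move=> sH; apply/matrixP => i j; rewrite [LHS]D_mxE [RHS]D_mxE.
by have [] := is_derivec_slice_fst s t i j sH.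
Qed.

End Slices.

(** * Curves of matrices *)

Section Curves.
Variable R : realType.
Local Notation M2 := 'M[R[i]]_2.
Implicit Types (F G : curve R) (s : R).

Lemma ddt_segment (a b : R) F G s : a < b -> s \in `[a, b] ->
  (forall r, r \in `[a, b] -> F r = G r) ->
  derivable_mx F s 1 -> derivable_mx G s 1 -> ddt F s = ddt G s.
Proof.
move=> ab sab FG dF dG; apply/matrixP => i j; rewrite [LHS]D_mxE [RHS]D_mxE.
by apply: (f_equal2 (@Complex R)); apply: (derive_segment ab sab);
  [move=> r /FG ->|exact: (dF i j).1|exact: (dG i j).1
  |move=> r /FG ->|exact: (dF i j).2|exact: (dG i j).2].
Qed.

Lemma smooth_antiderivative (F f : R -> R) :
  (forall s, is_derive s 1 F (f s)) -> smooth f -> smooth F.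
Proof.
move=> dF sf; have cF := is_derive_continuous dF.
have dFv (s v : R) : is_derive s v F (v * f s).
  have /derivable1_diffP dFs : derivable F s 1 by have [] := dF s.
  split; first exact: diff_derivable.
  have <- : 'D_1 F s = f s by have [] := dF s.
  by rewrite !deriveE// -[v in LHS]mulr1 [LHS]linearZ.
case=> [|k]; first exact: cF.
split=> [|s v|v]; [exact: cF|by have [] := dFv s v|].
under eq_fun do rewrite (@derive_val _ _ _ _ _ _ _ (dFv _ v)).
by apply: class_CM => //; exact: class_C_cst.
Qed.

End Curves.

(** * The logarithmic derivative of a horizontal curve *)

Section LogarithmicDerivative.
Variable R : realType.
Local Notation M2 := 'M[R[i]]_2.
Implicit Types (g v : curve R) (s : R).

(** Off [0, L] the matrices of a horizontal curve are unconstrained, but they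
    remain invertible near each of its points: this is what makes derivatives
    at the endpoints computable. *)
Lemma near_unit g s : smooth_mx (V := R) g -> \det (g s) = 1 ->
  \forall r \near s, \det (g r) != 0.
Proof.
move=> sg ds; have sdet : smoothc (V := R) (fun r => \det (g r)).
  under eq_fun do rewrite det2E -mulN1r.
  by apply: smoothcD; [|apply: smoothcM; first by split; exact: smooth_cst];
    apply: smoothcM; exact: sg.
have cdet := smooth_continuous sdet.1 (x := s).
have : complex.Re (\det (g s)) != 0 by rewrite ds /= oner_neq0.
move=> /(cvgr_neq0 _ cdet); apply: filterS => r.
by apply: contra => /eqP ->.
Qed.

Lemma derivable_mx_invmxM g v s : smooth_mx (V := R) g -> \det (g s) = 1 ->
  derivable_mx (V := R) v s 1 ->
  derivable_mx (V := R) (fun r => invmx (g r) *m v r) s 1.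
Proof.
move=> sg ds dv i j.
have dg := smooth_mx_derivable s 1 sg.
pose w r := (\det (g r))^-1 * (adj2 (g r) *m v r) i j.
have wE : \forall r \near s, w r = (invmx (g r) *m v r) i j.
  apply: filterS (near_unit sg ds) => r dr.
  by rewrite invmx_adj2 (negbTE dr) -scalemxAl [RHS]mxE.
have dw : derivablec (V := R) w s 1.
  apply: derivablecM.
    apply: derivablecV; first by rewrite ds oner_neq0.
    under eq_fun do rewrite det2E -mulN1r.
    have dc (c : R[i]) : derivablec (V := R) (fun=> c) s 1.
      by split; exact (derivable_cst _ _ _).
    by apply: derivablecD; [|apply: derivablecM; first exact: dc];
      apply: derivablecM; exact: dg.
  exact: (derivable_mxM (smooth_mx_derivable s 1 (smooth_mx_adj2 sg)) dv).
split.
- apply: near_eq_derivable dw.1; apply: filterS wE => r -> //.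
- apply: near_eq_derivable dw.2; apply: filterS wE => r -> //.
Qed.

(** Differentiate g (g^-1 v) = v, valid near s. *)
Lemma ddt_invmxM g v s : smooth_mx (V := R) g -> \det (g s) = 1 ->
  derivable_mx (V := R) v s 1 ->
  ddt (fun r => invmx (g r) *m v r) s =
  invmx (g s) *m (ddt v s - ddt g s *m (invmx (g s) *m v s)).
Proof.
move=> sg ds dv; have ug : g s \in unitmx by rewrite unitmxE ds unitr1.
have dW := derivable_mx_invmxM sg ds dv.
have E : ddt v s = ddt (fun r => g r *m (invmx (g r) *m v r)) s.
  apply: near_eq_D_mx; apply: filterS (near_unit sg ds) => r dr.
  by rewrite mulKVmx// unitmxE unitfE.
have := D_mxM (smooth_mx_derivable s 1 sg) dW.
rewrite -/(ddt _ _) -/(ddt g s) -/(ddt _ _) -E => ->.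
by rewrite addrC addKr mulKmx.
Qed.

End LogarithmicDerivative.

Section HorizontalCurves.
Variables (R : realType) (L : R).
Hypothesis hL : 0 < L.
Local Notation M2 := 'M[R[i]]_2.
Implicit Types (g V : curve R) (s : R).

(** The logarithmic derivative with the adjugate in place of the inverse: it
    is smooth on the whole line, whatever g does outside [0, L]. *)
Definition lam g : curve R := fun s => adj2 (g s) *m ddt g s.

Lemma smooth_lam g : smooth_mx (V := R) g -> smooth_mx (V := R) (lam g).
Proof.
by move=> sg; apply: smooth_mxM; [exact: smooth_mx_adj2|exact: smooth_D_mx].
Qed.

Lemma Lam_lam g s : HorizD L g -> s \in `[0, L] -> Lam g s = lam g s.
Proof.
move=> [_ Gg _ _] /Gg ds; rewrite /Lam /lam invmx_adj2 ds oner_eq0 invr1.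
by rewrite scale1r.
Qed.

Lemma B1_pauli : B1 R = pauli (2^-1) 0 0.
Proof.
have half : 2^-1 = (2^-1 : R)%:C by rewrite fmorphV rmorph_nat.
apply/matrixP; apply: ord2_ind; apply: ord2_ind;
  rewrite !mxE /= ?mulr0n ?mulr1n ?expr0 ?expr1 ?mulr0 ?mulr1 ?mulrN1 ?half;
  by apply: complex_eq; rewrite /= ?oppr0.
Qed.

(** Conjugation by a unitary matrix preserves the traceless Hermitian matrices
    and their inner product, and dot B1 B1 = 1/4. *)
Lemma Lam_sphere g s : HorizD L g -> s \in `[0, L] ->
  herm0 (lam g s) /\ dot (lam g s) (lam g s) = 4^-1.
Proof.
move=> Hg sL; rewrite -Lam_lam//; have [_ _ _ [r [_ Kr _ ->//]]] := Hg.
have [/unitarymxP rr _] := Kr _ sL.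
have rr' : (r s)^t* *m r s = 1%:M by apply: mulmx1C.
have [hB tB] : herm0 (B1 R) by rewrite B1_pauli; exact: herm0_pauli.
have h : herm0 (r s *m B1 R *m (r s)^t*).
  split; last by rewrite mxtrace_mulC mulmxA rr' mul1mx.
  have rK : ((r s)^t*)^t* = r s by apply/matrixP => i j; rewrite !mxE conjCK.
  by rewrite !trmx_mul !map_mxM hB rK mulmxA.
split=> //; apply: (@mulfI _ 4) => //.
apply: (@complexI R); rewrite -pairing_dot//.
rewrite /pairing -!mulmxA mxtrace_mulC !mulmxA.
rewrite -(mulmxA _ _ (r s)) rr' mulmx1.
rewrite -(mulmxA _ _ (r s)) rr' mulmx1.
rewrite -/(pairing _ _) pairing_dot// B1_pauli /dot !x_pauli.
by congr (_%:C); field.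
Qed.

End HorizontalCurves.

(** * The form in Pauli coordinates *)

Section Omega.
Variables (R : realType) (L : R).
Hypothesis hL : 0 < L.
Local Notation M2 := 'M[R[i]]_2.
Local Notation mu := (@lebesgue_measure R).
Implicit Types (g V : curve R) (s : R).

Lemma smooth_vol_curves g V1 V2 : smooth_mx (V := R) g ->
  smooth_mx (V := R) V1 -> smooth_mx (V := R) V2 ->
  smooth (fun s : R => 8 * vol (lam g s) (ddt V1 s) (ddt V2 s)).
Proof.
move=> sg s1 s2; apply: smoothM; first exact: smooth_cst.
by apply: smooth_vol; [exact: smooth_lam|exact: smooth_D_mx..].
Qed.

(** The brackets of Hermitian matrices are skew-Hermitian, so the integrand is
    imaginary and dividing by i makes the form real. *)
Lemma omegaE g V1 V2 : HorizD L g ->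
  (forall s, s \in `[0, L] -> herm0 (ddt V1 s)) ->
  (forall s, s \in `[0, L] -> herm0 (ddt V2 s)) ->
  omega L g V1 V2 =
  (\int[mu]_(s in `[0, L]) (8 * vol (lam g s) (ddt V1 s) (ddt V2 s)))%:C.
Proof.
move=> Hg h1 h2; set I := Rintegral _ _ _.
suff -> : omega L g V1 V2 = 'i^-1 * (0 +i* I).
  have -> : 0 +i* I = 'i * I%:C by apply: complex_eq; rewrite !ReImE /=; ring.
  by rewrite mulKf// -?complexiE ?eq_complex /= ?oner_eq0 ?andbF// neq0Ci.
have pE s : s \in `[0, L] -> pairing (Lam g s) (bracket (ddt V1 s) (ddt V2 s)) =
    0 +i* (8 * vol (lam g s) (ddt V1 s) (ddt V2 s)).
  move=> sL; rewrite (Lam_lam Hg sL) pairing_bracket//; [|exact: h1|exact: h2].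
  exact: (Lam_sphere Hg sL).1.
rewrite /omega /integral_C; congr (_ * (_ +i* _)).
- rewrite (eq_Rintegral _ (g := fun=> 0)); last by move=> s /set_mem/= sL; rewrite pE.
  by rewrite Rintegral_cst// mul0r.
- by apply: eq_Rintegral => s /set_mem/= sL; rewrite pE.
Qed.

Lemma herm0_ddt V s : smooth_mx (V := R) V ->
  (forall r, r \in `[0, L] -> herm0 (V r)) -> s \in `[0, L] -> herm0 (ddt V s).
Proof.
move=> sV hV sL.
have sP : smooth_mx (V := R) (fun r => pauli (x1 (V r)) (x2 (V r)) (x3 (V r))).
  by apply: smooth_mx_pauli; [exact: smooth_x1|exact: smooth_x2|exact: smooth_x3].
rewrite (ddt_segment hL sL (G := fun r => pauli (x1 (V r)) (x2 (V r)) (x3 (V r)))).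
- rewrite /ddt D_mx_pauli; first exact: herm0_pauli.
  + exact: smooth_derivable (smooth_x1 sV).
  + exact: smooth_derivable (smooth_x2 sV).
  + exact: smooth_derivable (smooth_x3 sV).
- by move=> r /hV /herm0E.
- exact: smooth_mx_derivable.
- exact: smooth_mx_derivable.
Qed.

Lemma TD_herm0 g V s : TD L g V -> s \in `[0, L] -> herm0 (ddt V s).
Proof. by move=> [sV hV _ _ _]; exact: herm0_ddt. Qed.

Lemma TD_orthogonal g V s : HorizD L g -> TD L g V -> s \in `[0, L] ->
  dot (lam g s) (ddt V s) = 0.
Proof.
move=> Hg TV sL; have [_ _ _ _ /(_ s sL)] := TV.
rewrite (Lam_lam Hg sL) pairing_dot;
  [|exact: (Lam_sphere Hg sL).1|exact: TD_herm0 TV sL].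
by move=> /complexI /eqP; rewrite mulf_eq0 pnatr_eq0/= => /eqP.
Qed.

(** The conditions of a form restrict to a smaller space of curves with smaller
    tangent spaces: this yields the frame-periodic case. *)
Lemma two_formW (M M' : set (curve R)) (T T' : curve R -> set (curve R)) om :
  M' `<=` M -> (forall g, T' g `<=` T g) -> two_form M T om -> two_form M' T' om.
Proof.
move=> MM TT [om1 om2 om3 om4]; split.
- by move=> g V1 V2 /MM Mg /TT T1 /TT T2; exact: om1.
- by move=> g a V1 V2 V3 /MM Mg /TT T1 /TT T2 /TT T3; exact: om2.
- by move=> g V1 V2 /MM Mg /TT T1 /TT T2; exact: om3.
- move=> n h V1 V2 [sh Mh] s1 s2 T1 T2; apply: om4 => // [|t|t].
  + by split=> // t; exact/MM.
  + exact/TT.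
  + exact/TT.
Qed.

Lemma closed_formW (M M' : set (curve R)) om :
  M' `<=` M -> closed_form L M om -> closed_form L M' om.
Proof.
by move=> MM cl n h V [sh Mh] rep; apply: cl => //; split=> // t; exact/MM.
Qed.

Section Families.
Variables (n : nat) (h : 'rV[R]_n -> curve R).
Local Notation X := (R * 'rV[R]_n)%type.

(** A family of curves as one function of the curve parameter s and the family
    parameter t; partial derivatives are directional derivatives of it. *)
Definition joint (p : X) : M2 := h p.2 p.1.
Definition along_s : X := (1, 0).
Definition lam_joint (p : X) : M2 := adj2 (joint p) *m D_mx along_s joint p.

Hypothesis sh : jointly_smooth h.

Lemma smooth_lam_joint : smooth_mx lam_joint.
Proof.
by apply: smooth_mxM; [exact: smooth_mx_adj2|exact: smooth_D_mx].
Qed.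

Lemma ddt_joint s t : ddt (h t) s = D_mx along_s joint (s, t).
Proof. exact: (ddt_slice s t sh). Qed.

Lemma lam_jointE s t : lam (h t) s = lam_joint (s, t).
Proof. by rewrite /lam /lam_joint ddt_joint. Qed.

End Families.

Lemma two_form_HorizD : two_form (HorizD L) (TD L) (omega L).
Proof.
have ci (f : R -> R) : smooth (V := R) f -> mu.-integrable `[0, L] (EFin \o f).
  by move=> /smooth_continuous; exact: continuous_integrable.
split.
- move=> g V1 V2 Hg T1 T2; rewrite (omegaE Hg).
  + by rewrite complex_real.
  + by move=> s; exact: TD_herm0 T1.
  + by move=> s; exact: TD_herm0 T2.
- move=> g a V1 V2 V3 Hg T1 T2 T3; have [sg _ _ _] := Hg.
  have [[s1 _ _ _ _] [s2 _ _ _ _] [s3 _ _ _ _]] := And3 T1 T2 T3.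
  have E s : ddt (fun s => a%:C *: V1 s + V2 s) s = a%:C *: ddt V1 s + ddt V2 s.
    by apply: D_mx_lin; exact: smooth_mx_derivable.
  have h1 s := @TD_herm0 g V1 s T1.
  have h2 s := @TD_herm0 g V2 s T2.
  have h3 s := @TD_herm0 g V3 s T3.
  have h12 s : s \in `[0, L] -> herm0 (ddt (fun s => a%:C *: V1 s + V2 s) s).
    by move=> sL; rewrite E; apply: herm0_lin; [exact: h1|exact: h2].
  rewrite (omegaE Hg h12 h3) (omegaE Hg h1 h3) (omegaE Hg h2 h3).
  rewrite -rmorphM -rmorphD; congr (_%:C).
  rewrite -RintegralZl//; last exact/ci/smooth_vol_curves.
  rewrite -RintegralD//; first last.
  + exact/ci/smooth_vol_curves.
  + by apply: ci; apply: smoothM; [exact: smooth_cst|exact: smooth_vol_curves].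
  apply: eq_Rintegral => s /set_mem/= sL.
  by rewrite E (vol_lin a _ _ (h1 s sL) (h2 s sL)) mulrDr mulrCA.
- move=> g V1 V2 Hg T1 T2; have [sg _ _ _] := Hg.
  have [s1 _ _ _ _] := T1; have [s2 _ _ _ _] := T2.
  rewrite !(omegaE Hg); try by [move=> s; exact: TD_herm0 T1
     |move=> s; exact: TD_herm0 T2].
  rewrite -rmorphN; congr (_%:C); rewrite -mulN1r -RintegralZl//; last first.
    exact/ci/smooth_vol_curves.
  by apply: eq_Rintegral => s _; rewrite volC; ring.
- move=> n h V1 V2 [sh Mh] s1 s2 T1 T2.
  have -> : (fun t => complex.Re (omega L (h t) (V1 t) (V2 t))) =
      integral_over 0 L (fun p => 8 * vol (lam_joint h p)
        (D_mx (along_s n) (joint V1) p) (D_mx (along_s n) (joint V2) p)).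
    apply/funext => t; rewrite (omegaE (Mh t)) /=.
    + by apply: eq_Rintegral => s _; rewrite (lam_jointE sh) !ddt_joint.
    + by move=> s; exact: TD_herm0 (T1 t).
    + by move=> s; exact: TD_herm0 (T2 t).
  apply: smooth_integral_over => //; apply: smoothM; first exact: smooth_cst.
  by apply: smooth_vol; [exact: smooth_lam_joint|exact: smooth_D_mx..].
Qed.

End Omega.

(** * Closedness *)

Section Closed.
Variables (R : realType) (L : R).
Hypothesis hL : 0 < L.
Local Notation M2 := 'M[R[i]]_2.
Local Notation mu := (@lebesgue_measure R).
Variables (n : nat) (h : 'rV[R]_n -> curve R).
Hypothesis Mh : smooth_family (HorizD L) h.
Local Notation X := (R * 'rV[R]_n)%type.
Local Notation Lam_h := (lam_joint h).

Let sh : jointly_smooth h := Mh.1.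

Definition along_t (j : 'I_n) : X := (0, delta_mx 0 j).

Lemma joint_lam s t : s \in `[0, L] ->
  joint h (s, t) *m Lam_h (s, t) = D_mx (along_s R n) (joint h) (s, t).
Proof.
move=> sL; have [_ /(_ s sL) d1 _ _] := Mh.2 t.
by rewrite /lam_joint mulmxA mulmx_adj2 [\det _]d1 mul1mx.
Qed.

(** The velocity of Lambda. In the notation W = h^-1 v, differentiating
    h lam = dh/ds in t_j gives the mixed second derivative of h, which is also
    dv/ds; [bracket_variation] then identifies dW/ds + [W, lam] with the
    derivative of lam in t_j. *)
Lemma ddt_variation (j : 'I_n) V s t : s \in `[0, L] ->
  represents L (h t) (velocity h j t) V ->
  ddt V s = D_mx (along_t j) Lam_h (s, t).
Proof.
move=> sL [_ _ /(_ s sL) ->].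
have [sg Gg _ _] := Mh.2 t; have dg := Gg s sL : \det (h t s) = 1.
have ug : h t s \in unitmx by rewrite unitmxE dg unitr1.
have vE : velocity h j t = fun r => D_mx (along_t j) (joint h) (r, t).
  by apply/funext => r; exact: (D_mx_slice r t (delta_mx 0 j) sh).
have svj := smooth_D_mx (along_t j) sh.
have dv : derivable_mx (V := R) (velocity h j t) s 1.
  by rewrite vE; exact: derivable_mx_slice_fst.
rewrite (ddt_invmxM sg dg dv) (Lam_lam (Mh.2 t) sL) (lam_jointE sh) (ddt_joint sh).
have -> : ddt (velocity h j t) s = D_mx (along_t j) (D_mx (along_s R n) (joint h)) (s, t).
  by rewrite vE (ddt_slice s t svj) D_mx_comm.
have E : D_mx (along_t j) (D_mx (along_s R n) (joint h)) (s, t) =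
    velocity h j t s *m Lam_h (s, t) + h t s *m D_mx (along_t j) Lam_h (s, t).
  have sl := smooth_lam_joint sh.
  rewrite -(D_mx_slice s t (delta_mx 0 j) (smooth_D_mx (along_s R n) sh)).
  rewrite -(D_mx_slice s t (delta_mx 0 j) sl).
  have -> : (fun u => D_mx (along_s R n) (joint h) (s, u)) =
            (fun u => joint h (s, u) *m Lam_h (s, u)).
    by apply/funext => u; rewrite joint_lam.
  exact: (D_mxM (derivable_mx_slice s t _ sh) (derivable_mx_slice s t _ sl)).
rewrite -joint_lam// E -[joint h (s, t)]/(h t s).
exact: bracket_variation.
Qed.

(** The length of lam is constant in the parameters. *)
Lemma D_lam_orthogonal s t j : s \in `[0, L] ->
  dot (Lam_h (s, t)) (D_mx (along_t j) Lam_h (s, t)) = 0.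
Proof.
move=> sL; have sl := smooth_lam_joint sh.
have sd := smooth_dot sl sl.
have [_ dE] := is_derive_slice (smooth_derivable (x := (s, t)) (v := along_t j) sd).
have : 'D_(along_t j) (fun p => dot (Lam_h p) (Lam_h p)) (s, t) = 0.
  rewrite -dE (_ : (fun u => _) = (fun=> 4^-1)); first exact: derive_cst.
  apply/funext => u /=; rewrite -(lam_jointE sh).
  exact: (Lam_sphere (Mh.2 u) sL).2.
rewrite (derive_dot _ _ sl sl) (dotC (D_mx (along_t j) Lam_h (s, t))) -mulr2n => /eqP.
by rewrite mulrn_eq0 /= => /eqP.
Qed.

Lemma D_lam_herm0 s t j : s \in `[0, L] -> herm0 (D_mx (along_t j) Lam_h (s, t)).
Proof.
move=> sL; have sl := smooth_lam_joint sh.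
rewrite -(D_mx_slice s t (delta_mx 0 j) sl).
have -> : (fun u => Lam_h (s, u)) = (fun u => pauli (x1 (Lam_h (s, u)))
   (x2 (Lam_h (s, u))) (x3 (Lam_h (s, u)))).
  apply/funext => u; apply: herm0E; rewrite -(lam_jointE sh).
  exact: (Lam_sphere (Mh.2 u) sL).1.
rewrite D_mx_pauli; first exact: herm0_pauli.
- by have [] := is_derive_slice
    (smooth_derivable (x := (s, t)) (v := along_t j) (smooth_x1 sl)).
- by have [] := is_derive_slice
    (smooth_derivable (x := (s, t)) (v := along_t j) (smooth_x2 sl)).
- by have [] := is_derive_slice
    (smooth_derivable (x := (s, t)) (v := along_t j) (smooth_x3 sl)).
Qed.

Definition omega_density (j k : 'I_n) (p : X) : R :=
  8 * vol (Lam_h p) (D_mx (along_t j) Lam_h p) (D_mx (along_t k) Lam_h p).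

Lemma smooth_omega_density j k : smooth (omega_density j k).
Proof.
have sl := smooth_lam_joint sh.
apply: smoothM; first exact: smooth_cst.
by apply: smooth_vol => //; exact: smooth_D_mx.
Qed.

(** Symmetry of second derivatives lets them cancel in pairs; the first
    derivatives are coplanar, being orthogonal to lam. *)
Lemma cyclic_omega_density s t i j k : s \in `[0, L] ->
  'D_(along_t i) (omega_density j k) (s, t) + 'D_(along_t j) (omega_density k i) (s, t)
    + 'D_(along_t k) (omega_density i j) (s, t) = 0.
Proof.
move=> sL; have sl := smooth_lam_joint sh.
have sD a := smooth_D_mx (along_t a) sl.
pose l := Lam_h (s, t); pose D a := D_mx (along_t a) Lam_h (s, t).
pose D2 a b := D_mx (along_t a) (D_mx (along_t b) Lam_h) (s, t).
have D2C a b : D2 a b = D2 b a by exact: D_mx_comm.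
have dE a b c x y : D2 a b = x -> D2 a c = y ->
    'D_(along_t a) (omega_density b c) (s, t) =
    8 * (vol (D a) (D b) (D c) + vol l x (D c) + vol l (D b) y).
  move=> <- <-; have sv := smooth_vol sl (sD b) (sD c).
  have d8 : 'D_(along_t a) (fun _ : X => 8 : R) (s, t) = 0 by exact: derive_cst.
  have := deriveME (smooth_derivable (x := (s, t)) (v := along_t a) (@smooth_cst R X 8))
    (smooth_derivable (x := (s, t)) (v := along_t a) sv).
  rewrite d8 mulr0 addr0 (derive_vol _ _ sl (sD b) (sD c)); exact.
have coplanar : vol (D i) (D j) (D k) = 0.
  have := vol_orthogonal (D_lam_orthogonal t i sL) (D_lam_orthogonal t j sL)
    (D_lam_orthogonal t k sL).
  rewrite -{1 2}(lam_jointE sh) (Lam_sphere (Mh.2 t) sL).2 => /eqP.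
  by rewrite mulf_eq0 invr_eq0 pnatr_eq0 /= => /eqP.
apply: etrans (cyclic_vol l (D2 i j) (D2 j k) (D2 i k) coplanar).
exact (f_equal2 +%R (f_equal2 +%R (dE i j k _ _ erefl erefl)
  (dE j k i _ _ erefl (D2C j i))) (dE k i j _ _ (D2C k i) (D2C k j))).
Qed.

Lemma Re_omega_families (V : 'I_n -> 'rV[R]_n -> curve R) j k :
  (forall j t, represents L (h t) (velocity h j t) (V j t)) ->
  (fun t => complex.Re (omega L (h t) (V j t) (V k t))) =
  integral_over 0 L (omega_density j k).
Proof.
move=> rep; apply/funext => t.
have VE a s : s \in `[0, L] -> ddt (V a t) s = D_mx (along_t a) Lam_h (s, t).
  by move=> sL; exact: ddt_variation.
rewrite (omegaE (Mh.2 t)) /=.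
- by apply: eq_Rintegral => s /set_mem/= sL; rewrite (VE j s sL) (VE k s sL) (lam_jointE sh).
- by move=> s sL; rewrite (VE j s sL); exact: D_lam_herm0.
- by move=> s sL; rewrite (VE k s sL); exact: D_lam_herm0.
Qed.

End Closed.

Lemma closed_HorizD (R : realType) (L : R) : 0 < L ->
  closed_form L (HorizD L) (omega L).
Proof.
move=> hL n h V Mh rep om_h partial i j k t.
have sD a b := smooth_omega_density Mh a b.
have sDD a b c : smooth ('D_(along_t R a) (omega_density h b c)) by exact: smooth_derive (sD b c).
have partialE a b c : partial a (om_h b c) t =
    integral_over 0 L ('D_(along_t R a) (omega_density h b c)) t.
  rewrite /partial /om_h (Re_omega_families Mh b c rep).
  apply: derive_val; apply: is_derive_integral_over => //.
  - exact: smooth_continuous (sD b c).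
  - by move=> x; exact: smooth_derivable (sD b c).
  - exact: smooth_continuous (sDD a b c).
pose f a b c s := 'D_(along_t R a) (omega_density h b c) (s, t).
have cf a b c : continuous (f a b c).
  apply: (continuous_slice (Phi := fun p => 'D_(along_t R a) (omega_density h b c) p)).
  exact: smooth_continuous (sDD a b c).
have cD (u v : R -> R) : continuous u -> continuous v ->
    continuous (fun s => u s + v s).
  by move=> cu cv s; exact: (continuousD (cu s) (cv s)).
have ci u : continuous u -> (@lebesgue_measure R).-integrable `[0, L] (EFin \o u).
  exact: continuous_integrable.
rewrite (partialE i j k) (partialE j k i) (partialE k i j) /integral_over.
rewrite -(RintegralD _ (ci _ (cf i j k)) (ci _ (cf j k i)))//.
rewrite -(RintegralD _ (ci _ (cD _ _ (cf i j k) (cf j k i))) (ci _ (cf k i j)))//.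
rewrite (eq_Rintegral _ (g := fun=> 0)) ?Rintegral_cst ?mul0r//.
by move=> s /set_mem/= sL; exact: (cyclic_omega_density Mh t i j k sL).
Qed.

(** * Non-degeneracy *)

Section NonDegeneracy.
Variables (R : realType) (L : R).
Hypothesis hL : 0 < L.
Local Notation M2 := 'M[R[i]]_2.
Local Notation mu := (@lebesgue_measure R).
Implicit Types (g V : curve R) (s : R).

(** Integrating the coordinates keeps the antiderivative Hermitian and traceless
    on the whole line, even where Z is neither. *)
Lemma pauli_antiderivative (Z : curve R) : smooth_mx (V := R) Z ->
  exists Y : curve R, [/\ smooth_mx (V := R) Y, forall s, herm0 (Y s), Y 0 = 0
    & forall s, ddt Y s = pauli (x1 (Z s)) (x2 (Z s)) (x3 (Z s))].
Proof.
move=> sZ.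
have [s1 s2 s3] := And3 (smooth_x1 sZ) (smooth_x2 sZ) (smooth_x3 sZ).
have [a a0 da] := antiderivative (smooth_continuous s1).
have [b b0 db] := antiderivative (smooth_continuous s2).
have [c c0 dc] := antiderivative (smooth_continuous s3).
exists (fun s => pauli (a s) (b s) (c s)); split.
- by apply: smooth_mx_pauli;
    [exact: smooth_antiderivative da s1|exact: smooth_antiderivative db s2
    |exact: smooth_antiderivative dc s3].
- by move=> s; exact: herm0_pauli.
- rewrite a0 b0 c0; apply/matrixP; apply: ord2_ind; apply: ord2_ind;
    by rewrite !mxE /=; apply: complex_eq; rewrite /= ?oppr0.
- move=> s; have [[ea Ea] [eb Eb] [ec Ec]] := And3 (da s) (db s) (dc s).
  by rewrite /ddt (D_mx_pauli ea eb ec) Ea Eb Ec.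
Qed.

Lemma constant_of_derive0 (f : R -> R) : smooth (V := R) f ->
  (forall s, s \in `[0, L] -> 'D_1 f s = 0) -> forall s, s \in `[0, L] -> f s = f 0.
Proof.
move=> sf f0 s /[!in_itv]/= /andP[s0 sL].
have df (x : R) : is_derive x 1 f ('D_1 f x) by apply: derivableP; exact: smooth_derivable.
have cf : {within `[0, s], continuous f}.
  exact/continuous_subspaceT/smooth_continuous.
have [c /[!in_itv]/= /andP[c0 cs] /eqP] := MVT_segment s0 (fun x _ => df x) cf.
rewrite f0 ?in_itv/= ?c0 ?(le_trans cs)// mul0r subr_eq0 => /eqP //.
Qed.

Lemma eq0_of_ddt0 V : smooth_mx (V := R) V -> V 0 = 0 ->
  (forall s, s \in `[0, L] -> ddt V s = 0) -> forall s, s \in `[0, L] -> V s = 0.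
Proof.
move=> sV V0 dV s sL; rewrite -V0; apply/matrixP => i j.
apply: complex_eq.
- apply: (constant_of_derive0 (f := fun r => complex.Re (V r i j)) (sV i j).1) => // r rL.
  by have /(congr1 (fun A : M2 => complex.Re (A i j))) := dV r rL; rewrite D_mxE mxE.
- apply: (constant_of_derive0 (f := fun r => complex.Im (V r i j)) (sV i j).2) => // r rL.
  by have /(congr1 (fun A : M2 => complex.Im (A i j))) := dV r rL; rewrite D_mxE mxE.
Qed.

(** Y' is half of V' turned by a right angle in the plane orthogonal to lam, so
    omega g V Y is twice the integral of |V'|^2.  The formula for Y' is part of
    the conclusion, because it shows that Y' is periodic when lam and V' are. *)
Lemma TD_partner g V : HorizD L g -> TD L g V ->
  (exists2 s, s \in `[0, L] & V s != 0) ->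
  exists Y, [/\ TD L g Y, forall s, ddt Y s = cross (lam g s) (ddt V s)
    & omega L g V Y != 0].
Proof.
move=> Hg TV [s0 s0L Vs0].
have [sg _ _ _] := Hg; have [sV hV V0 dV0 _] := TV.
have sl := smooth_lam sg; have sdV : smooth_mx (V := R) (ddt V) by exact: smooth_D_mx.
have [Y [sY hY Y0 dY]] := pauli_antiderivative (smooth_cross sl sdV).
have dYE s : ddt Y s = cross (lam g s) (ddt V s) by rewrite dY !x_pauli.
have TY : TD L g Y.
  split=> //.
  - rewrite dYE dV0 /cross /x1 /x2 /x3 !mxE /= !mulr0 subrr.
    apply/matrixP; apply: ord2_ind; apply: ord2_ind;
      by rewrite !mxE /=; apply: complex_eq; rewrite /= ?oppr0.
  - move=> s sL; rewrite (Lam_lam Hg sL) dYE pairing_dot ?dot_crossl ?mulr0//.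
      exact: (Lam_sphere Hg sL).1.
    exact: herm0_pauli.
exists Y; split=> //.
rewrite (omegaE Hg (fun s => @TD_herm0 _ _ hL g V s TV) (fun s => @TD_herm0 _ _ hL g Y s TY)).
apply/negP => /eqP /complexI I0; move/negP: Vs0; apply; apply/eqP.
apply: eq0_of_ddt0 s0L => // s sL.
apply: herm0_dot_eq0; first exact: (TD_herm0 hL TV sL).
have volE r : r \in `[0, L] ->
    8 * vol (lam g r) (ddt V r) (ddt Y r) = 2 * dot (ddt V r) (ddt V r).
  move=> rL; rewrite dYE vol_cross (Lam_sphere Hg rL).2 (TD_orthogonal hL Hg TV rL).
  by field.
have /(_ s sL) : forall r, r \in `[0, L] -> 8 * vol (lam g r) (ddt V r) (ddt Y r) = 0.
  apply: (integral_ge0_eq0 hL _ _ I0).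
    exact/smooth_continuous/smooth_vol_curves.
  move=> r rL; rewrite volE// mulr_ge0// /dot -!expr2.
  by rewrite !addr_ge0 ?sqr_ge0.
by rewrite volE// => /eqP; rewrite mulf_eq0 pnatr_eq0/= => /eqP.
Qed.

End NonDegeneracy.

Theorem theorem8 (R : realType) (L : R) (hL : 0 < L) :
  symplectic L (HorizD L) (TD L) (omega L) /\
  symplectic L (HorizPD L) (TPD L) (omega L).
Proof.
have PD_D : HorizPD L `<=` HorizD L by move=> g [].
have TPD_TD g : TPD L g `<=` TD L g by move=> V [].
split; split.
- exact: two_form_HorizD.
- exact: closed_HorizD.
- move=> X TX g Hg Xg.
  by have [Y [TY _ oY]] := TD_partner hL Hg (TX g Hg) Xg; exists Y.
- exact: two_formW PD_D TPD_TD (two_form_HorizD hL).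
- exact: closed_formW PD_D (closed_HorizD hL).
- move=> X TX g Hg Xg.
  have [Hg' [P [sP perP PE]]] := Hg; have [TV [Q [sQ perQ QE]]] := TX g Hg.
  have [Y [TY dY oY]] := TD_partner hL Hg' TV Xg; exists Y => //; split=> //.
  exists (fun s => cross (P s) (Q s)); split.
  + exact: smooth_cross.
  + by move=> s; rewrite perP perQ.
  + by move=> s sL; rewrite PE// QE// dY (Lam_lam Hg' sL).
Qed.
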